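(* Let $D=X^4+16X^2+24X+9\in\mathbb Q[X]$, let $\sqrt D\in\mathbb Q((X^{-1}))$ be the square root with leading term $X^2$, and let $\alpha=(\sqrt D-3)/X$. Then $D$ is not Pellian, and there are infinitely many prime numbers $p$ such that the continued fraction of $\alpha$ has good reduction at $p$; in particular, for these $p$, every partial quotient $a_n$ of $\alpha$ has all its coefficients in $\mathbb Z_{(p)}$ (i.e. $p$ never divides a denominator of a coefficient of any $a_n$).
   Context: Laurent series: $\mathbb Q((X^{-1}))$, elements $\sum_{n\le N}t_nX^n$, with $\operatorname{ord}(\sum_{n\le N}t_nX^n)=-N$ if $t_N\ne0$; $\lfloor\beta\rfloor$ is the unique polynomial with $\operatorname{ord}(\beta-\lfloor\beta\rfloor)>0$. Continued fraction of $\alpha$: complete quotients $\alpha_0=\alpha$, $\alpha_{n+1}=1/(\alpha_n-\lfloor\alpha_n\rfloor)$, partial quotients $a_n=\lfloor\alpha_n\rfloor$. Good reduction at $p$ means: for all $n\ge0$, $\alpha_n$ has all coefficients in $\mathbb Z_{(p)}$ (the localisation of $\mathbb Z$ at $p$) and its coefficientwise reduction mod $p$ equals the $n$-th complete quotient of the reduction of $\alpha$ mod $p$ in $\mathbb F_p((X^{-1}))$. $D$ is Pellian if there exist $p,q\in\mathbb Q[X]$, $q\ne0$, with $p^2-Dq^2\in\mathbb Q^*$. *)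

(* Defs.v *)
From HB Require Import structures.
From mathcomp Require Import all_boot all_order all_algebra.
Set Implicit Arguments. Unset Strict Implicit. Unset Printing Implicit Defensive.
Import Order.TTheory GRing.Theory Num.Theory.
Local Open Scope ring_scope.

(* A Laurent series sum_{n <= N} t_n X^n over K, given by its coefficient
   function n |-> t_n (n : int) together with an upper bound N of its support. *)
Record lser (K : nzRingType) := LSer {
  lcoef : int -> K;
  lbound : int;
  lboundP : forall n : int, lbound < n -> lcoef n = 0 }.

Section Laurent.
Variable K : nzRingType.

Definition leqs (f g : lser K) : Prop := forall n, lcoef f n = lcoef g n.

Lemma lconst_boundP (c : K) :
  forall n : int, 0 < n -> (if n == 0 then c else 0) = 0.
Proof. by move=> n hn; rewrite gt_eqF. Qed.
Definition lconst (c : K) : lser K := LSer (@lconst_boundP c).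
Definition lone : lser K := lconst 1.

Lemma ladd_boundP (f g : lser K) :
  forall n : int, Num.max (lbound f) (lbound g) < n -> lcoef f n + lcoef g n = 0.
Proof.
move=> n; rewrite gt_max => /andP[hf hg].
by rewrite (lboundP hf) (lboundP hg) addr0.
Qed.
Definition ladd (f g : lser K) : lser K := LSer (@ladd_boundP f g).

Lemma lopp_boundP (f : lser K) :
  forall n : int, lbound f < n -> - lcoef f n = 0.
Proof. by move=> n hn; rewrite (lboundP hn) oppr0. Qed.
Definition lopp (f : lser K) : lser K := LSer (@lopp_boundP f).
Definition lsub (f g : lser K) : lser K := ladd f (lopp g).

(* Cauchy product: coefficient of X^n is sum_{i+j=n} f_i g_j, where i ranges
   over [n - Ng, Nf] (all other terms vanish). *)
Definition lmul_coef (f g : lser K) (n : int) : K :=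
  let Nf := lbound f in let Ng := lbound g in
  if n <= Nf + Ng then
    \sum_(k < (absz (Nf + Ng - n)%R).+1)
        lcoef f (Nf - k%:Z) * lcoef g (n - Nf + k%:Z)
  else 0.
Lemma lmul_boundP (f g : lser K) :
  forall n : int, lbound f + lbound g < n -> lmul_coef f g n = 0.
Proof. by move=> n hn; rewrite /lmul_coef leNgt hn. Qed.
Definition lmul (f g : lser K) : lser K := LSer (@lmul_boundP f g).

Lemma lfloor_boundP (f : lser K) :
  forall n : int, lbound f < n -> (if 0 <= n then lcoef f n else 0) = 0.
Proof. by move=> n hn; rewrite (lboundP hn); case: ifP. Qed.
Definition lfloor (f : lser K) : lser K := LSer (@lfloor_boundP f).

Lemma ldivX_boundP (f : lser K) :
  forall n : int, lbound f - 1 < n -> lcoef f (n + 1) = 0.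
Proof. by move=> n hn; apply: lboundP; rewrite -ltrBlDr. Qed.
Definition ldivX (f : lser K) : lser K := LSer (@ldivX_boundP f).

Lemma lpoly_boundP (p : {poly K}) :
  forall n : int, (size p)%:Z < n ->
    (if 0 <= n then p`_(absz n) else 0) = 0.
Proof.
move=> n hn; case: ifP => // hn0; apply: nth_default.
have -> : n = (absz n)%:Z by rewrite gez0_abs.
move: hn; rewrite gez0_abs // => hn.
by apply/ltnW; rewrite -ltz_nat gez0_abs.
Qed.
Definition lpoly (p : {poly K}) : lser K := LSer (@lpoly_boundP p).

Definition cf_seq (A : nat -> lser K) (a : lser K) : Prop :=
  leqs (A 0%N) a /\
  forall n : nat, leqs (lmul (A n.+1) (lsub (A n) (lfloor (A n)))) lone.

End Laurent.

Definition in_Zloc (p : nat) (r : rat) : bool := ~~ (p %| `|denq r|)%N.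

Definition redp (p : nat) (r : rat) : 'F_p := (numq r)%:~R / (denq r)%:~R.

Lemma lred_boundP (p : nat) (f : lser rat) :
  forall n : int, lbound f < n -> redp p (lcoef f n) = 0.
Proof. by move=> n hn; rewrite (lboundP hn) /redp mul0r. Qed.
Definition lred (p : nat) (f : lser rat) : lser 'F_p := LSer (@lred_boundP p f).

Definition good_reduction (p : nat) (alpha : lser rat) : Prop :=
  exists (A : nat -> lser rat) (B : nat -> lser 'F_p),
    cf_seq A alpha /\ cf_seq B (lred p alpha) /\
    forall n : nat, (forall k : int, in_Zloc p (lcoef (A n) k)) /\
                    leqs (lred p (A n)) (B n).

Definition pellian (D : {poly rat}) : Prop :=
  exists P Q : {poly rat}, Q != 0 /\
    exists c : rat, c != 0 /\ P ^+ 2 - D * Q ^+ 2 = c%:P.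

Definition Dpoly : {poly rat} := 'X^4 + 16%:P * 'X^2 + 24%:P * 'X + 9%:P.

Definition alpha_of (s : lser rat) : lser rat := ldivX (lsub s (lconst 3)).

(* Main.v *)
Require Import Defs.
From HB Require Import structures.
From mathcomp Require Import all_boot all_order all_algebra all_field.
From mathcomp Require Import boolp.
From mathcomp Require Import zify ring.
Set Implicit Arguments. Unset Strict Implicit. Unset Printing Implicit Defensive.
Import Order.TTheory GRing.Theory Num.Theory.
Local Open Scope ring_scope.

(** The complete quotients of [alpha] are [(sqrt D + r_n) / (c_n (X - x_n))] with
    [r_(n+1) = X^2 + 8 + e_n], where [(x_n, e_n)] starts at [(0, -5)] and moves on
    the curve [-2 e x^2 + 24 x - 55 - 16 e - e^2 = 0] by
    [x' = 12 / e - x] and [e' = -16 - 2 x'^2 - e]; the continued fraction has good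
    reduction at [p] as soon as no [e_n] vanishes in [F_p].

    If [a^2 = 2], then [D] has the factor [G = X^2 + a X + 9 - 6 a], and the
    resultant of [G] with [D - r_(n+1)^2] shows that [G(x_n) G(x_(n+1))] is a
    square; since [G(0) = 3 (a - 1)^2], every [G(x_n)] lies in the square class
    of 3, whereas [e_n = 0] would make [G(x_n)] a square.  Hence any prime [p]
    such that 2 and -3 are squares and -1 is not is a prime of good reduction, and
    there are infinitely many of them among the divisors of [x^4 + 2 x^2 + 25].

    For the first claim, a Pell solution is a unit [u = P + Q sqrt D], which can be
    normalised so that its norm is prime to 3.  Let [k > 0] be its degree and
    [w = X^2 + 8 + sqrt D], of degree 2 and norm [55 - 24 X].  Then
    [h = conj(u)^2 w^k] has degree 0 and a 3-adic unit as leading coefficient, and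
    [h conj(h)] is a constant times [(55 - 24 X)^k].  Modulo [3^(v_3(k) + 2)] this
    power is linear with a nonzero coefficient of [X], so [conj(h)] has degree at
    most 1; hence [conj(h) - h], a multiple of [sqrt D], vanishes modulo that power
    of 3, and so does the coefficient of [X] in [h conj(h)], a contradiction. *)

(** * The ring of Laurent series *)

Definition vanish_above (K : nzRingType) (f : int -> K) (N : int) : Prop :=
  forall n : int, N < n -> f n = 0.

Lemma vanish_aboveW (K : nzRingType) (f : int -> K) (N M : int) :
  N <= M -> vanish_above f N -> vanish_above f M.
Proof. by move=> NM fN n Mn; apply: fN; apply: le_lt_trans Mn. Qed.

Section Convolution.
Variable K : nzRingType.
Implicit Types f g : int -> K.

(* The coefficient of [X^(N + M - d)] in the product of [f] and [g] when [N] and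
   [M] bound their supports. *)
Definition conv f g (N M : int) (d : nat) : K :=
  \sum_(k < d.+1) f (N - k%:Z) * g (M - (d - k)%N%:Z).

Lemma conv_shiftl f g N M d (j : nat) : vanish_above f N ->
  conv f g (N + j%:Z) M (d + j) = conv f g N M d.
Proof.
move=> fN; elim: j => [|j IHj]; first by rewrite addr0 addn0.
rewrite -IHj /conv addnS big_ord_recl subr0 fN ?mul0r ?add0r; last lia.
apply: eq_bigr => k _; rewrite /= /bump leq0n subSS.
by congr (f _ * _); lia.
Qed.

Lemma conv_shiftr f g N M d (j : nat) : vanish_above g M ->
  conv f g N (M + j%:Z) (d + j) = conv f g N M d.
Proof.
move=> gM; elim: j => [|j IHj]; first by rewrite addr0 addn0.
rewrite -IHj /conv addnS big_ord_recr /= subnn subr0 (gM (M + _)) ?mulr0 ?addr0; last lia.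
apply: eq_bigr => k _; congr (_ * g _); have := ltn_ord k; lia.
Qed.

(** Both sides are moved to the common bounds [Num.max N N'] and [Num.max M M'], which only adds
    zero terms. So the Cauchy product does not depend on the recorded bounds. *)
Lemma conv_indep f g N M d N' M' d' :
    vanish_above f N -> vanish_above g M -> vanish_above f N' ->
    vanish_above g M' -> N + M - d%:Z = N' + M' - d'%:Z ->
  conv f g N M d = conv f g N' M' d'.
Proof.
move=> fN gM fN' gM' E.
pose j := absz (Num.max N N' - N); pose j' := absz (Num.max N N' - N').
pose i := absz (Num.max M M' - M); pose i' := absz (Num.max M M' - M').
have Ej : N + j%:Z = N' + j'%:Z by lia.
have Ei : M + i%:Z = M' + i'%:Z by lia.
have Ed : (d + j + i = d' + j' + i')%N by lia.
rewrite -(conv_shiftl g M d j fN) -(conv_shiftr _ (N + j%:Z) (d + j) i gM).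
by rewrite Ej Ei Ed conv_shiftr // conv_shiftl.
Qed.

Lemma lmul_coef_conv (f g : lser K) N M d :
    vanish_above (lcoef f) N -> vanish_above (lcoef g) M ->
  lcoef (lmul f g) (N + M - d%:Z) = conv (lcoef f) (lcoef g) N M d.
Proof.
move=> fN gM.
have fb : vanish_above (lcoef f) (lbound f) by exact: lboundP.
have gb : vanish_above (lcoef g) (lbound g) by exact: lboundP.
rewrite /= /lmul_coef; case: ifPn => [le|].
  set e := absz _; have Ee : e%:Z = lbound f + lbound g - (N + M - d%:Z) by lia.
  rewrite (@conv_indep _ _ N M d (lbound f) (lbound g) e) //; last lia.
  apply: eq_bigr => k _; congr (_ * lcoef g _); have := ltn_ord k; lia.
rewrite -ltNge => lt; rewrite /conv big1 // => k _; have := ltn_ord k => ltk.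
case: (ltP (lbound f) (N - k%:Z)) => [/fb ->|lef]; first by rewrite mul0r.
by rewrite (gb (M - _)) ?mulr0 //; lia.
Qed.

(** Truncating and reversing turns series into polynomials, whose product is already known to be
    commutative and associative. *)
Lemma conv_poly f g N M d T : (d <= T)%N ->
  conv f g N M d =
  (\poly_(i < T.+1) f (N - i%:Z) * \poly_(i < T.+1) g (M - i%:Z))`_d.
Proof.
move=> dT; rewrite coefM; apply: eq_bigr => k _; rewrite !coef_poly.
have := ltn_ord k => ltk.
by rewrite !ifT //; lia.
Qed.

End Convolution.

(** The bound of an [lser] is data, so one series has many representations. Hiding it in an
    existential makes equality coefficientwise, as a ring structure requires. *)
Record laurent (K : nzRingType) := Laurent {
  lc :> int -> K;
  lc_vanish : exists N, vanish_above lc N }.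

HB.instance Definition _ (K : nzRingType) := gen_eqMixin (laurent K).
HB.instance Definition _ (K : nzRingType) := gen_choiceMixin (laurent K).

Section LaurentRing.
Variable K : comNzRingType.
Implicit Types f g h : laurent K.

Lemma laurentP f g : (forall n, f n = g n) -> f = g.
Proof.
case: f g => [f Pf] [g Pg] /= /funext E; case: _ / E in Pg *.
by rewrite (Prop_irrelevance Pf Pg).
Qed.

Lemma lser_vanish (f : lser K) : exists N, vanish_above (lcoef f) N.
Proof. by exists (lbound f); apply: lboundP. Qed.

Definition of_lser (f : lser K) : laurent K := Laurent (lser_vanish f).

Definition to_lser f : lser K :=
  let NP := cid (lc_vanish f) in @LSer K f (sval NP) (svalP NP).

Lemma to_lserK f : of_lser (to_lser f) = f.
Proof. exact: laurentP. Qed.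

Lemma of_lserP (f g : lser K) : leqs f g <-> of_lser f = of_lser g.
Proof.
split=> [fg|E n]; first exact: laurentP.
exact: (congr1 (fun h : laurent K => h n) E).
Qed.

Definition laur_const (c : K) : laurent K := of_lser (lconst c).
Definition laur_add f g : laurent K := of_lser (ladd (to_lser f) (to_lser g)).
Definition laur_opp f : laurent K := of_lser (lopp (to_lser f)).
Definition laur_mul f g : laurent K := of_lser (lmul (to_lser f) (to_lser g)).

Lemma laur_mulE f g N M d : vanish_above f N -> vanish_above g M ->
  laur_mul f g (N + M - d%:Z) = conv f g N M d.
Proof. exact: (@lmul_coef_conv _ (to_lser f) (to_lser g)). Qed.

Lemma laur_mul_vanish f g N M : vanish_above f N -> vanish_above g M ->
  vanish_above (laur_mul f g) (N + M).
Proof.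
move=> fN gM n lt.
(* Raising the bound of [g] by [e] makes [n] the top index, where the convolution has a single
   term. *)
pose e := absz (n - (N + M))%R.
rewrite (_ : n = N + (M + e%:Z) - 0%:Z); last lia.
rewrite laur_mulE //; last by apply: vanish_aboveW gM; lia.
by rewrite /conv big_ord1 /= (gM (M + _ - _)) ?mulr0 //; lia.
Qed.

Lemma laur_eqP f g N : vanish_above f N -> vanish_above g N ->
  (forall d : nat, f (N - d%:Z) = g (N - d%:Z)) -> f = g.
Proof.
move=> fN gN E; apply: laurentP => n.
case: (ltP N n) => [lt|le]; first by rewrite fN ?gN.
by rewrite (_ : n = N - (absz (N - n))%:Z) //; lia.
Qed.

Lemma laur_addA : associative laur_add.
Proof. by move=> f g h; apply: laurentP => n /=; rewrite addrA. Qed.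
Lemma laur_addC : commutative laur_add.
Proof. by move=> f g; apply: laurentP => n /=; rewrite addrC. Qed.
Lemma laur_add0 : left_id (laur_const 0) laur_add.
Proof. by move=> f; apply: laurentP => n /=; case: ifP; rewrite add0r. Qed.
Lemma laur_addN : left_inverse (laur_const 0) laur_opp laur_add.
Proof. by move=> f; apply: laurentP => n /=; case: ifP; rewrite addNr. Qed.

HB.instance Definition _ :=
  GRing.isZmodule.Build (laurent K) laur_addA laur_addC laur_add0 laur_addN.

Lemma laur_mulC : commutative laur_mul.
Proof.
move=> f g; have [N fN] := lc_vanish f; have [M gM] := lc_vanish g.
apply: (@laur_eqP _ _ (N + M)).
- exact: laur_mul_vanish.
- by rewrite addrC; apply: laur_mul_vanish.
move=> d; rewrite laur_mulE // (addrC N) laur_mulE //.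
by rewrite !(@conv_poly _ _ _ _ _ _ d) // mulrC.
Qed.

Lemma laur_mulA : associative laur_mul.
Proof.
move=> f g h; have [N fN] := lc_vanish f; have [M gM] := lc_vanish g.
have [R hR] := lc_vanish h.
have fg := laur_mul_vanish fN gM; have gh := laur_mul_vanish gM hR.
apply: (@laur_eqP _ _ (N + (M + R))).
- exact: laur_mul_vanish.
- by rewrite addrA; apply: laur_mul_vanish.
move=> d; rewrite laur_mulE // addrA laur_mulE //.
pose T (u : int -> K) (B : int) := \poly_(i < d.+1) u (B - i%:Z).
transitivity ((T f N * (T g M * T h R))`_d).
  rewrite coefM; apply: eq_bigr => k _; have := ltn_ord k => ltk.
  rewrite {1}/T coef_poly ltk laur_mulE // (@conv_poly _ _ _ _ _ _ d) //; lia.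
rewrite mulrA coefM; apply: eq_bigr => k _; have := ltn_ord k => ltk.
rewrite {3}/T coef_poly ifT ?laur_mulE // ?(@conv_poly _ _ _ _ _ _ d) //; lia.
Qed.

Lemma laur_mul1 : left_id (laur_const 1) laur_mul.
Proof.
move=> f; have [N fN] := lc_vanish f.
have v1 : vanish_above (laur_const 1) 0 by exact: lconst_boundP.
apply: (@laur_eqP _ _ (0 + N)); first exact: laur_mul_vanish.
  by rewrite add0r.
move=> d; rewrite laur_mulE // /conv big_ord_recl big1 ?addr0 => [|k _] /=.
  by rewrite mul1r subn0 add0r.
by rewrite mul0r.
Qed.

Lemma laur_mulD : left_distributive laur_mul laur_add.
Proof.
move=> f g h; have [N0 fN0] := lc_vanish f; have [N1 gN1] := lc_vanish g.
have [M hM] := lc_vanish h.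
pose N := Num.max N0 N1.
have fN : vanish_above f N by apply: vanish_aboveW fN0; lia.
have gN : vanish_above g N by apply: vanish_aboveW gN1; lia.
have fgN : vanish_above (laur_add f g) N.
  by move=> n lt /=; rewrite fN ?gN ?addr0.
apply: (@laur_eqP _ _ (N + M)); first exact: laur_mul_vanish.
  move=> n lt; rewrite {1}/laur_add /=.
  by rewrite [lmul_coef _ _ _](laur_mul_vanish fN hM lt)
             [lmul_coef _ _ _](laur_mul_vanish gN hM lt) addr0.
move=> d; rewrite laur_mulE //.
have -> : laur_add (laur_mul f h) (laur_mul g h) (N + M - d%:Z)
  = laur_mul f h (N + M - d%:Z) + laur_mul g h (N + M - d%:Z) by [].
rewrite !laur_mulE // /conv -big_split /=; apply: eq_bigr => k _.
by rewrite mulrDl.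
Qed.

Lemma laur_one_neq0 : laur_const 1 != 0 :> laurent K.
Proof.
by apply/eqP => /(congr1 (fun f : laurent K => f 0)) /eqP; rewrite /= oner_eq0.
Qed.

HB.instance Definition _ := GRing.Zmodule_isComNzRing.Build (laurent K)
  laur_mulA laur_mulC laur_mul1 laur_mulD laur_one_neq0.

End LaurentRing.

(** * Leading terms, constants, polynomials and floors of Laurent series *)

Section LaurentTheory.
Variable K : comNzRingType.
Implicit Types f g h : laurent K.

Lemma lcD f g n : (f + g) n = f n + g n. Proof. by []. Qed.
Lemma lcN f n : (- f) n = - f n. Proof. by []. Qed.
Lemma lcB f g n : (f - g) n = f n - g n. Proof. by []. Qed.
Lemma lcC c n : laur_const c n = if n == 0 then c else 0 :> K. Proof. by []. Qed.
Lemma lc0 n : (0 : laurent K) n = 0. Proof. by rewrite lcC if_same. Qed.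
Lemma lc1 n : (1 : laurent K) n = (n == 0)%:R. Proof. by rewrite lcC; case: eqP. Qed.

Lemma lcM f g N M d : vanish_above f N -> vanish_above g M ->
  (f * g) (N + M - d%:Z) = conv f g N M d.
Proof. exact: laur_mulE. Qed.

Lemma vanishM f g N M : vanish_above f N -> vanish_above g M ->
  vanish_above (f * g) (N + M).
Proof. exact: laur_mul_vanish. Qed.

Lemma vanishD f g N : vanish_above f N -> vanish_above g N ->
  vanish_above (f + g) N.
Proof. by move=> fN gN n lt; rewrite lcD fN ?gN ?addr0. Qed.

Lemma vanishN f N : vanish_above f N -> vanish_above (- f) N.
Proof. by move=> fN n lt; rewrite lcN fN ?oppr0. Qed.

Lemma vanishC c : vanish_above (laur_const c : laurent K) 0.
Proof. exact: lconst_boundP. Qed.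

Lemma lcM_top f g N M : vanish_above f N -> vanish_above g M ->
  (f * g) (N + M) = f N * g M.
Proof.
by move=> fN gM; have := lcM 0 fN gM; rewrite /conv big_ord1 /= !subr0.
Qed.

Lemma vanishX f N k : vanish_above f N -> vanish_above (f ^+ k) (N * k%:Z).
Proof.
move=> fN; elim: k => [|k IHk]; first by rewrite mulr0; apply: vanishC.
by rewrite exprS intS mulrDr mulr1; apply: vanishM.
Qed.

Lemma lcX_top f N k : vanish_above f N -> (f ^+ k) (N * k%:Z) = f N ^+ k.
Proof.
move=> fN; elim: k => [|k IHk]; first by rewrite mulr0 expr0 lc1.
by rewrite !exprS intS mulrDr mulr1 lcM_top ?IHk //; apply: vanishX.
Qed.

Lemma lcCM c f n : (laur_const c * f) n = c * f n.
Proof.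
have [N fN] := lc_vanish f; have cf := vanishM (@vanishC c) fN.
case: (ltP N n) => [lt|le]; first by rewrite cf ?fN ?mulr0 ?add0r.
rewrite (_ : n = 0 + N - (absz (N - n))%:Z); last lia.
rewrite lcM //; last exact: vanishC.
rewrite /conv big_ord_recl big1 ?addr0 => [|k _] /=; last by rewrite mul0r.
by rewrite subn0 add0r.
Qed.

Lemma laurC_zmod : zmod_morphism (@laur_const K).
Proof.
by move=> a b; apply: laurentP => n; rewrite lcB !lcC; case: ifP; rewrite ?subr0.
Qed.
Lemma laurC_monoid : monoid_morphism (@laur_const K).
Proof.
split=> // a b; apply: laurentP => n; rewrite lcCM !lcC.
by case: ifP; rewrite ?mulr0.
Qed.
HB.instance Definition _ :=
  GRing.isZmodMorphism.Build K (laurent K) (@laur_const K) laurC_zmod.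
HB.instance Definition _ :=
  GRing.isMonoidMorphism.Build K (laurent K) (@laur_const K) laurC_monoid.

Lemma laurX_vanish : exists N, vanish_above (fun n : int => (n == 1)%:R : K) N.
Proof. by exists 1 => n lt; rewrite gt_eqF. Qed.
Definition laurX : laurent K := Laurent laurX_vanish.

Lemma vanish_laurX : vanish_above laurX 1.
Proof. by move=> n lt /=; rewrite gt_eqF. Qed.

Lemma lcXM f n : (laurX * f) n = f (n - 1).
Proof.
have [N fN] := lc_vanish f; have Xf := vanishM vanish_laurX fN.
case: (ltP (1 + N) n) => [lt|le]; first by rewrite Xf // fN //; lia.
rewrite (_ : n = 1 + N - (absz (1 + N - n)%R)%:Z); last lia.
rewrite (lcM _ vanish_laurX fN).
rewrite /conv big_ord_recl big1 ?addr0 => [|k _] /=; last first.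
  by rewrite /bump leq0n (_ : (_ == _) = false) ?mul0r //; lia.
by rewrite mul1r subn0; congr (lc f _); lia.
Qed.

(* The expansion of [1 / (X - x)]. *)
Definition laur_geom_fun (x : K) (n : int) : K :=
  if n < 0 then x ^+ (absz n).-1 else 0.
Lemma laur_geom_vanish x : exists N, vanish_above (laur_geom_fun x) N.
Proof. by exists 0 => n lt; rewrite /laur_geom_fun ltNge ltW. Qed.
Definition laur_geom x : laurent K := Laurent (laur_geom_vanish x).

Lemma laur_geomP x : (laurX - laur_const x) * laur_geom x = 1.
Proof.
apply: laurentP => n; rewrite mulrBl lcB lcXM lcCM lc1 /= /laur_geom_fun.
case: (ltP n 0) => [lt|le].
  rewrite ifT; last lia.
  rewrite -exprS (_ : (absz n).-1.+1 = (absz (n - 1)).-1); last lia.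
  by rewrite subrr (_ : (n == 0) = false) //; lia.
rewrite mulr0 subr0; case: eqP => [->|/eqP n0]; first by rewrite /= expr0.
by rewrite ifF //; lia.
Qed.

Definition laur_poly (p : {poly K}) : laurent K :=
  (map_poly (@laur_const K) p).[laurX].

HB.instance Definition _ := GRing.RMorphism.copy laur_poly
  (horner_eval laurX \o map_poly (@laur_const K)).

Lemma laur_polyC c : laur_poly c%:P = laur_const c.
Proof. by rewrite /laur_poly map_polyC hornerC. Qed.
Lemma laur_polyX : laur_poly 'X = laurX.
Proof. by rewrite /laur_poly map_polyX hornerX. Qed.

Lemma lc_poly p n :
  laur_poly p n = if 0 <= n then p`_(absz n) else 0.
Proof.
elim/poly_ind: p n => [|p c IHp] n; first by rewrite rmorph0 lc0 coef0 if_same.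
have -> : laur_poly (p * 'X + c%:P) = laur_poly p * laurX + laur_const c.
  by rewrite rmorphD rmorphM /= laur_polyC laur_polyX.
rewrite mulrC lcD lcXM IHp lcC.
rewrite coefD coefMX coefC.
by case: n => [[|n]|n] /=; rewrite ?add0r ?addr0 ?subn1.
Qed.

Lemma of_lpoly p : of_lser (lpoly p) = laur_poly p.
Proof. by apply: laurentP => n; rewrite lc_poly. Qed.

Definition laur_floor f : laurent K := of_lser (lfloor (to_lser f)).

Lemma lc_floor f n : laur_floor f n = if 0 <= n then f n else 0.
Proof. by []. Qed.

Lemma laur_floorP f p g : f = laur_poly p + g -> vanish_above g (-1) ->
  f - laur_floor f = g.
Proof.
move=> -> gv; apply: laurentP => n; rewrite lcB lc_floor lcD.
case: ifP => [le|/negbT]; first by rewrite subrr gv //; lia.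
by move=> /negbTE lt; rewrite lc_poly lt add0r subr0.
Qed.

Lemma of_lserM (f g : lser K) : of_lser (lmul f g) = of_lser f * of_lser g.
Proof.
have fv : vanish_above (of_lser f) (lbound f) by exact: lboundP.
have gv : vanish_above (of_lser g) (lbound g) by exact: lboundP.
apply: (@laur_eqP _ _ _ (lbound f + lbound g)).
- by move=> n lt; apply: (@lboundP _ (lmul f g)).
- exact: vanishM.
by move=> d; rewrite lcM //; exact: (@lmul_coef_conv _ f g).
Qed.

Definition laur_cf (A : nat -> laurent K) (a : laurent K) : Prop :=
  A 0%N = a /\ forall n, A n.+1 * (A n - laur_floor (A n)) = 1.

Lemma cf_seqE (A : nat -> lser K) (a : lser K) :
  cf_seq A a <-> laur_cf (fun n => of_lser (A n)) (of_lser a).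
Proof.
have E n : (of_lser (lmul (A n.+1) (lsub (A n) (lfloor (A n)))) = 1) <->
   (of_lser (A n.+1) * (of_lser (A n) - laur_floor (of_lser (A n))) = 1).
  rewrite of_lserM.
  rewrite (_ : of_lser (lsub _ _) = of_lser (A n) - laur_floor (of_lser (A n))) //.
  exact: laurentP.
split=> -[A0 AS]; split.
- exact/of_lserP.
- by move=> n; apply/E/of_lserP/AS.
- exact/of_lserP.
- by move=> n; apply/of_lserP/E/AS.
Qed.

(** Each complete quotient is an inverse of the fractional part of the previous one, and inverses
    are unique. *)
Lemma laur_cf_unique A B a : laur_cf A a -> laur_cf B a -> forall n, A n = B n.
Proof.
move=> [A0 AS] [B0 BS]; elim=> [|n IHn]; first by rewrite A0 B0.
have := AS n; rewrite IHn => An.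
by rewrite -[LHS]mulr1 -(BS n) mulrCA An mulr1.
Qed.

End LaurentTheory.

(** * The continued fraction *)

Definition Dlaur (K : comNzRingType) : laurent K :=
  laurX K ^+ 4 + 16 * laurX K ^+ 2 + 24 * laurX K + 9.

Lemma laur_poly_Dpoly : laur_poly Dpoly = Dlaur rat.
Proof.
have E (n : nat) : laur_poly (n%:R)%:P = n%:R :> laurent rat.
  by rewrite laur_polyC rmorph_nat.
pose f : {rmorphism {poly rat} -> laurent rat} := @laur_poly rat.
rewrite /Dpoly /Dlaur -[laur_poly _]/(f _) !(rmorphD f) !(rmorphXn f) !(rmorphM f).
by rewrite /= !laur_polyX !E.
Qed.

Section ContinuedFraction.
Variable F : fieldType.

(* [QuoState x e c] stands for the complete quotient
   [(sqrt D + X^2 - 2 x^2 - 8 - e) / (c (X - x))]; the parameter [e] is that of the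
   next one.  Only the fractional part agrees for the initial state. *)
Record quo_state := QuoState { qx : F; qe : F; qc : F }.

(** With [r = X^2 + 8 + e], the polynomial [D - r^2] is quadratic with leading coefficient [-2 e]
    and sum of roots [12 / e]. The step passes from the root [x] to the other root [x']; subtracting
    the polynomial part [2 (X + x') / c'] from the next quotient gives [e'], and [c c' = -2 e]. *)
Definition quo_step (t : quo_state) : quo_state :=
  let x' := 12 / qe t - qx t in
  QuoState x' (- 16 - 2 * x' ^+ 2 - qe t) (- 2 * qe t / qc t).

Definition quo n : quo_state := iter n quo_step (QuoState 0 (- 5) 1).

(** The left-hand side is the value at [qx t] of [D - (X^2 + 8 + e)^2] for [e = qe t]. *)
Definition quo_rel (t : quo_state) : Prop :=
  - 2 * qe t * qx t ^+ 2 + 24 * qx t - 55 - 16 * qe t - qe t ^+ 2 = 0.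

Lemma quo_rel0 : quo_rel (quo 0).
Proof. rewrite /quo_rel /=; ring. Qed.

(** At the new root [x'], the polynomials [X^2 + 8 + e'] and [X^2 + 8 + e] take opposite values, so
    their squares agree there. *)
Lemma quo_rel_step t : qe t != 0 -> quo_rel t -> quo_rel (quo_step t).
Proof.
case: t => x e c /= e0; rewrite /quo_rel /= => <-.
by field.
Qed.

(** Vieta's formula for the product of the two roots of the quadratic behind [quo_rel]. *)
Lemma quo_step_prod t : qe t != 0 -> quo_rel t ->
  2 * qe t * qx t * qx (quo_step t) = 55 + 16 * qe t + qe t ^+ 2.
Proof.
case: t => x e c /= e0; rewrite /quo_rel /= => H.
apply/eqP; rewrite -subr_eq0 -H; apply/eqP; by field.
Qed.

Variable S : laurent F.
Hypothesis S_sqr : S * S = Dlaur F.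
Hypothesis S_vanish : vanish_above S 2.
Hypothesis S_lead : S 2 = 1.
Hypothesis two_neq0 : 2 != 0 :> F.
Hypothesis qe_neq0 : forall n, qe (quo n) != 0.

Lemma Dlaur_coef3 : Dlaur F 3 = 0.
Proof.
rewrite /Dlaur.
have -> : laurX F ^+ 4 + 16 * laurX F ^+ 2 + 24 * laurX F + 9 =
  laurX F * (laurX F * (laurX F * (laurX F * 1)))
  + laur_const 16 * (laurX F * (laurX F * 1)) + laur_const 24 * (laurX F * 1)
  + laur_const 9 by rewrite !rmorph_nat; ring.
by rewrite !lcD !lcCM !lcXM !lc1 lcC /= !mulr0 !addr0.
Qed.

(** The coefficient of [X^3] in [S * S] is twice [S 1], and [D] has no cubic term. *)
Lemma sqrtD_coef1 : S 1 = 0.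
Proof.
have := lcM 1 S_vanish S_vanish; rewrite S_sqr.
rewrite (_ : 2 + 2 - _ = 3) // Dlaur_coef3 /conv !big_ord_recl big_ord0 /=.
rewrite !(subr0, S_lead) (_ : 2 - (bump 0 0)%:Z = 1) // addr0 mul1r mulr1.
move/esym/eqP; rewrite -mulr2n -mulr_natl mulf_eq0 (negbTE two_neq0) /=.
by move/eqP.
Qed.

(* Up to a scalar and the factor [X - x], the fractional part of a complete quotient. *)
Definition root_err (e : F) : laurent F :=
  S - laurX F ^+ 2 - 8 - laur_const e.

Lemma root_err_vanish e : vanish_above (root_err e) 0.
Proof.
have -> : root_err e = S - laurX F * (laurX F * 1) - laur_const 8 - laur_const e.
  by rewrite /root_err rmorph_nat; ring.
move=> n lt; rewrite !lcB !lcXM lc1 !lcC !(gt_eqF lt) !subr0.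
case: (ltP 2 n) => [n2|n2].
  by rewrite S_vanish // (_ : (_ == _) = false) ?subr0 //; lia.
have [->|->] : n = 1 \/ n = 2 by lia.
  by rewrite sqrtD_coef1 subr0.
by rewrite S_lead subrr.
Qed.

Definition quo_err (t : quo_state) : laurent F :=
  laur_const (qc t)^-1 * (laur_geom (qx t) * root_err (qe t)).

Lemma quo_err_vanish t : vanish_above (quo_err t) (-1).
Proof.
have g : vanish_above (laur_geom (qx t)) (-1).
  by move=> n lt /=; rewrite /laur_geom_fun ifF //; lia.
rewrite /quo_err -[-1]/(0 + (-1 + 0) : int); apply: vanishM; first exact: vanishC.
by apply: vanishM => //; apply: root_err_vanish.
Qed.

(** Index 0 is special: the polynomial part of [(S - 3) / X] is [X], whereas the general formula
    would give [2 X] at the initial state. *)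
Definition quo_poly (n : nat) : {poly F} :=
  if n is 0 then 'X else (2 / qc (quo n))%:P * ('X + (qx (quo n))%:P).

Definition cquo (n : nat) : laurent F := laur_poly (quo_poly n) + quo_err (quo n).

Lemma quo_relP n : quo_rel (quo n).
Proof.
by elim: n => [|n IHn]; [exact: quo_rel0 | exact: quo_rel_step].
Qed.

Lemma qc_neq0 n : qc (quo n) != 0.
Proof.
elim: n => [|n IHn]; first by rewrite oner_neq0.
by rewrite /= mulf_neq0 ?invr_neq0 // mulf_neq0 // oppr_eq0.
Qed.

(** With [r = X^2 + 8 + e], the factors are [(S + r) / (c' (X - x'))] and [(S - r) / (c (X - x))],
    and [D - r^2 = c c' (X - x) (X - x')]. *)
Lemma cquo_rec n : cquo n.+1 * quo_err (quo n) = 1.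
Proof.
have e0 := qe_neq0 n; have c0 := qc_neq0 n; have c1 := qc_neq0 n.+1.
have := quo_step_prod e0 (quo_relP n); rewrite -[quo_step _]/(quo n.+1).
have : qe (quo n) * (qx (quo n) + qx (quo n.+1)) = 12 by rewrite /=; field.
have he : qe (quo n.+1) = - 16 - 2 * qx (quo n.+1) ^+ 2 - qe (quo n) by [].
have : qc (quo n) * qc (quo n.+1) = - 2 * qe (quo n) by rewrite /=; field.
have -> : cquo n.+1 = laur_const (2 / qc (quo n.+1)) *
    (laurX F + laur_const (qx (quo n.+1))) + quo_err (quo n.+1).
  by rewrite /cquo -laur_polyX -!laur_polyC -rmorphD -rmorphM.
rewrite /quo_err /root_err he; move: c0 c1 => {he e0}.
move: (qx (quo n)) (qx (quo n.+1)) (qe (quo n)) (qc (quo n)) (qc (quo n.+1)).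
move=> x x' e c c' c0 c1 hc hs hp.
pose C := @laur_const F.
have gP := laur_geomP x; have gP' := laur_geomP x'.
have hcc : C c^-1 * C c = 1 by rewrite -rmorphM mulVf ?rmorph1.
have hcc' : C c'^-1 * C c' = 1 by rewrite -rmorphM mulVf ?rmorph1.
have hcC : C c * C c' = - 2 * C e.
  by transitivity (C (c * c')); [ring | rewrite hc; ring].
have hsC : C e * (C x + C x') = 12.
  by transitivity (C (e * (x + x'))); [ring | rewrite hs; ring].
have hpC : 2 * C e * C x * C x' = 55 + 16 * C e + C e ^+ 2.
  by transitivity (C (2 * e * x * x')); [ring | rewrite hp; ring].
have E2 : S * S - (laurX F ^+ 2 + 8 + C e) ^+ 2
    = - 2 * C e * ((laurX F - C x) * (laurX F - C x')).
  apply/eqP; rewrite -subr_eq0 S_sqr /Dlaur; apply/eqP.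
  transitivity ((24 - 2 * (C e * (C x + C x'))) * laurX F
    + (2 * C e * C x * C x' - (55 + 16 * C e + C e ^+ 2))); first ring.
  by rewrite hsC hpC; ring.
(* Absorbing the polynomial part puts the next quotient in the form [(S + r) / (c' (X - x'))]. *)
have E1 : C (2 / c') * (laurX F + C x') + C c'^-1 * (laur_geom x' *
    (S - laurX F ^+ 2 - 8 - C (- 16 - 2 * x' ^+ 2 - e)))
   = C c'^-1 * laur_geom x' * (S + (laurX F ^+ 2 + 8 + C e)).
  by rewrite -[C (2 / c') * _]mulr1 -[Z in _ * Z + _]gP'; ring.
rewrite -/C E1.
transitivity (C c^-1 * C c'^-1 * laur_geom x * laur_geom x'
  * (S * S - (laurX F ^+ 2 + 8 + C e) ^+ 2)); first ring.
rewrite E2 -hcC.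
transitivity ((C c^-1 * C c) * (C c'^-1 * C c') *
  ((laurX F - C x) * laur_geom x) * ((laurX F - C x') * laur_geom x')); first ring.
by rewrite gP gP' hcc hcc' !mulr1.
Qed.

Lemma laur_cf_cquo : laur_cf cquo (cquo 0).
Proof.
split=> // n.
rewrite (@laur_floorP _ _ (quo_poly n) (quo_err (quo n))) //; first exact: cquo_rec.
exact: quo_err_vanish.
Qed.

Lemma cquo0X : laurX F * cquo 0 = S - 3.
Proof.
have gP := laur_geomP (0 : F).
rewrite /cquo /quo_err /= laur_polyX invr1 rmorph1 /root_err mul1r.
rewrite rmorph0 subr0 in gP; rewrite rmorphN rmorph_nat /=.
rewrite mulrDr mulrA gP; ring.
Qed.

Lemma cquo0E (a : laurent F) : laurX F * a = S - 3 -> a = cquo 0.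
Proof.
move=> Ea; have gP := laur_geomP (0 : F); rewrite rmorph0 subr0 in gP.
by rewrite -[LHS]mul1r -gP -mulrA mulrCA Ea -cquo0X mulrCA mulrA gP mul1r.
Qed.

End ContinuedFraction.

(** * Reduction modulo [p] *)

Section Reduction.
Variable p : nat.
Hypothesis p_pr : prime p.

Lemma intr_Fp_eq0 (d : int) : (d%:~R == 0 :> 'F_p) = (p %| absz d)%N.
Proof. by rewrite -(dvdz_pcharf (pchar_Fp p_pr)). Qed.

(** Integrality and the value of the reduction are coupled, so that each closure property below
    yields both at once. *)
Definition red (r : rat) (t : 'F_p) : Prop := in_Zloc p r /\ redp p r = t.

(** The fraction need not be in lowest terms: its reduced denominator divides [d], hence is prime to
    [p] too. *)
Lemma red_frac (n d : int) : ~~ (p %| absz d)%N ->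
  red (n%:~R / d%:~R) (n%:~R / d%:~R).
Proof.
move=> pd; have d0 : d != 0 by apply: contraNneq pd => ->.
pose r : rat := n%:~R / d%:~R; rewrite -/r.
have E : n * denq r = numq r * d.
  apply: (@intr_inj rat); rewrite !intrM.
  have := divq_num_den r; rewrite {3}/r => H.
  have dq0 : (denq r)%:~R != 0 :> rat by rewrite intr_eq0 denq_neq0.
  have dd0 : d%:~R != 0 :> rat by rewrite intr_eq0.
  by apply/eqP; rewrite -eqr_div // H.
have pden : ~~ (p %| absz (denq r))%N.
  apply: contraNN pd => pden.
  suff : (denq r %| d)%Z by rewrite dvdzE; apply: dvdn_trans.
  rewrite -(@Gauss_dvdzr _ (numq r)); first by rewrite -E dvdz_mull.
  by rewrite coprimez_sym coprimezE coprime_num_den.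
split=> //; rewrite /redp.
apply/eqP; rewrite eqr_div ?intr_Fp_eq0 //.
by rewrite -!intrM E.
Qed.

Lemma redP r t : red r t -> exists n d : int,
  [/\ ~~ (p %| absz d)%N, r = n%:~R / d%:~R & t = n%:~R / d%:~R].
Proof.
move=> [rp <-]; exists (numq r), (denq r); split=> //.
by rewrite divq_num_den.
Qed.

Lemma red_int (n : int) : red n%:~R n%:~R.
Proof.
have := @red_frac n 1; rewrite !divr1; apply.
by rewrite dvdn1; apply: contraTneq p_pr => ->.
Qed.

Lemma red_nat (n : nat) : red n%:R n%:R.
Proof. exact: (red_int n). Qed.

Lemma red0 : red 0 0. Proof. exact: (red_nat 0). Qed.

Lemma redN r t : red r t -> red (- r) (- t).
Proof.
move=> /redP[n [d [pd -> ->]]].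
by rewrite -!mulNr -!intrN; apply: red_frac.
Qed.

Lemma redD r t r' t' : red r t -> red r' t' -> red (r + r') (t + t').
Proof.
move=> /redP[n [d [pd -> ->]]] /redP[n' [d' [pd' -> ->]]].
have d0 : d%:~R != 0 :> 'F_p by rewrite intr_Fp_eq0.
have d0' : d'%:~R != 0 :> 'F_p by rewrite intr_Fp_eq0.
have dQ : d%:~R != 0 :> rat by rewrite intr_eq0; apply: contraNneq pd => ->.
have dQ' : d'%:~R != 0 :> rat by rewrite intr_eq0; apply: contraNneq pd' => ->.
rewrite !addf_div // -!intrM -!intrD; apply: red_frac.
by rewrite abszM Euclid_dvdM // negb_or pd pd'.
Qed.

Lemma redB r t r' t' : red r t -> red r' t' -> red (r - r') (t - t').
Proof. by move=> h h'; apply: redD => //; apply: redN. Qed.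

Lemma redM r t r' t' : red r t -> red r' t' -> red (r * r') (t * t').
Proof.
move=> /redP[n [d [pd -> ->]]] /redP[n' [d' [pd' -> ->]]].
rewrite !mulf_div -!intrM; apply: red_frac.
by rewrite abszM Euclid_dvdM // negb_or pd pd'.
Qed.

Lemma redX r t k : red r t -> red (r ^+ k) (t ^+ k).
Proof.
move=> h; elim: k => [|k IHk]; first exact: (red_nat 1).
by rewrite !exprS; apply: redM.
Qed.

Lemma redV r t : t != 0 -> red r t -> red r^-1 t^-1.
Proof.
move=> t0 /redP[n [d [pd -> E]]]; rewrite E !invf_div; apply: red_frac.
by apply: contraNN t0; rewrite -intr_Fp_eq0 E => /eqP ->; rewrite mul0r.
Qed.

Lemma red_sum (I : Type) (s : seq I) (f : I -> rat) (g : I -> 'F_p) :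
  (forall i, red (f i) (g i)) -> red (\sum_(i <- s) f i) (\sum_(i <- s) g i).
Proof.
move=> fg; elim/big_rec2: _ => [|i x y _ h]; first exact: red0.
exact: redD.
Qed.

Definition laur_red (f : laurent rat) (g : laurent 'F_p) : Prop :=
  forall n, red (f n) (g n).

Lemma laur_redD f g f' g' : laur_red f g -> laur_red f' g' ->
  laur_red (f + f') (g + g').
Proof. by move=> h h' n; rewrite !lcD; apply: redD. Qed.

Lemma laur_redN f g : laur_red f g -> laur_red (- f) (- g).
Proof. by move=> h n; rewrite !lcN; apply: redN. Qed.

Lemma laur_redB f g f' g' : laur_red f g -> laur_red f' g' ->
  laur_red (f - f') (g - g').
Proof. by move=> h h'; apply: laur_redD => //; apply: laur_redN. Qed.

Lemma laur_redM f g f' g' : laur_red f g -> laur_red f' g' ->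
  laur_red (f * f') (g * g').
Proof.
move=> h h' n.
have [N1 v1] := lc_vanish f; have [N2 v2] := lc_vanish g.
have [M1 w1] := lc_vanish f'; have [M2 w2] := lc_vanish g'.
pose N := Num.max N1 N2; pose M := Num.max M1 M2.
have {}v1 : vanish_above f N by apply: vanish_aboveW v1; lia.
have {}v2 : vanish_above g N by apply: vanish_aboveW v2; lia.
have {}w1 : vanish_above f' M by apply: vanish_aboveW w1; lia.
have {}w2 : vanish_above g' M by apply: vanish_aboveW w2; lia.
case: (ltP (N + M) n) => [lt|le].
  by rewrite (vanishM v1 w1) // (vanishM v2 w2) //; apply: red0.
rewrite (_ : n = N + M - (absz (N + M - n)%R)%:Z); last lia.
by rewrite !lcM //; apply: red_sum => i; apply: redM.
Qed.

Lemma laur_redC r t : red r t -> laur_red (laur_const r) (laur_const t).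
Proof. by move=> h n; rewrite !lcC; case: ifP => // _; apply: red0. Qed.

Lemma laur_red_nat n : laur_red n%:R n%:R.
Proof.
rewrite -!(rmorph_nat (@laur_const _)).
exact/laur_redC/red_nat.
Qed.

Lemma laur_redX : laur_red (laurX rat) (laurX 'F_p).
Proof. by move=> n; apply: red_nat. Qed.

Lemma laur_red_exp f g k : laur_red f g -> laur_red (f ^+ k) (g ^+ k).
Proof.
move=> h; elim: k => [|k IHk]; first exact: (laur_red_nat 1).
by rewrite !exprS; apply: laur_redM.
Qed.

Lemma laur_red_geom x y : red x y -> laur_red (laur_geom x) (laur_geom y).
Proof.
move=> h n /=; rewrite /laur_geom_fun; case: ifP => _; last exact: red0.
exact: redX.
Qed.

Lemma laur_red_inj f g g' : laur_red f g -> laur_red f g' -> g = g'.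
Proof. by move=> h h'; apply: laurentP => n; rewrite -(h n).2 -(h' n).2. Qed.

Lemma laur_red_Dlaur : laur_red (Dlaur rat) (Dlaur 'F_p).
Proof.
exact: (laur_redD (laur_redD (laur_redD (laur_red_exp 4 laur_redX)
    (laur_redM (laur_red_nat 16) (laur_red_exp 2 laur_redX)))
  (laur_redM (laur_red_nat 24) laur_redX)) (laur_red_nat 9)).
Qed.

Definition laur_int (f : laurent rat) : Prop := forall n, in_Zloc p (f n).

Lemma laur_int_red (f : laurent rat) : laur_int f ->
  laur_red f (of_lser (lred p (to_lser f))).
Proof. by move=> h n; split. Qed.

Lemma laur_intD f g : laur_int f -> laur_int g -> laur_int (f + g).
Proof.
by move=> /laur_int_red h /laur_int_red h' n; have [] := laur_redD h h' n.
Qed.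

Lemma laur_intB f g : laur_int f -> laur_int g -> laur_int (f - g).
Proof.
by move=> /laur_int_red h /laur_int_red h' n; have [] := laur_redB h h' n.
Qed.

Lemma laur_intM f g : laur_int f -> laur_int g -> laur_int (f * g).
Proof.
by move=> /laur_int_red h /laur_int_red h' n; have [] := laur_redM h h' n.
Qed.

Section SquareRoot.
Variable S : laurent rat.
Hypothesis S_sqr : S * S = Dlaur rat.
Hypothesis S_vanish : vanish_above S 2.
Hypothesis S_lead : S 2 = 1.
Hypothesis p_odd : odd p.

(** Comparing coefficients in [S * S = D] expresses twice each coefficient of [S] through integral
    data and earlier coefficients, and 2 is invertible at [p]. *)
Lemma sqrtD_int : laur_int S.
Proof.
have two : 2 != 0 :> 'F_p.
  rewrite -[2]/(2%:~R) intr_Fp_eq0 dvdn_prime2 //.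
  by apply: contraTneq p_odd => ->.
have H d : in_Zloc p (S (2 - d%:Z)).
  elim/ltn_ind: d => -[|d] IHd.
    by rewrite subr0 S_lead; have [] := red_nat 1.
  have := lcM d.+1 S_vanish S_vanish.
  rewrite S_sqr; set D := lc (Dlaur rat) _.
  rewrite /conv big_ord_recl big_ord_recr /= subnn !subr0 S_lead.
  rewrite -[bump 0 d]/d.+1 mul1r mulr1 subn0.
  set m := \sum_(i < d) _ => E.
  have mint : in_Zloc p m.
    rewrite /m.
    have [] // : red m (\sum_(i < d) redp p (S (2 - (bump 0 i)%:Z))
          * redp p (S (2 - (d.+1 - bump 0 i)%N%:Z))).
    by apply: red_sum => i; have := ltn_ord i => lti; apply: redM; split=> //;
       apply: IHd; rewrite /bump leq0n; lia.
  have Dint : in_Zloc p D by have [] := laur_red_Dlaur (2 + 2 - d.+1%:Z).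
  have -> : S (2 - d.+1%:Z) = (D - m) / 2 by rewrite E; field.
  have [] // : red ((D - m) / 2) ((redp p D - redp p m) / 2).
  by apply: redM; [apply: redB; split | apply: redV => //; apply: red_nat].
move=> n; case: (ltP 2 n) => [lt|le]; first by rewrite S_vanish //; have [] := red0.
by rewrite (_ : n = 2 - (absz (2 - n)%R)%:Z) //; lia.
Qed.

End SquareRoot.

(** The recursion divides only by [qe] and [qc], whose reductions are nonzero by hypothesis, so it
    commutes with reduction. *)
Lemma red_quo n : (forall k, qe (quo 'F_p k) != 0) ->
    (forall k, qc (quo 'F_p k) != 0) ->
  [/\ red (qx (quo rat n)) (qx (quo 'F_p n)), red (qe (quo rat n)) (qe (quo 'F_p n))
    & red (qc (quo rat n)) (qc (quo 'F_p n))].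
Proof.
move=> e0 c0; elim: n => [|n [hx he hc]].
  by split; [exact: red0 | apply/redN/red_nat | exact: (red_nat 1)].
have hx' : red (qx (quo rat n.+1)) (qx (quo 'F_p n.+1)).
  by apply: redB => //; apply: redM; [exact: red_nat | apply: redV].
split=> //.
  apply: redB => //; apply: redB; first by apply/redN/red_nat.
  by apply: redM; [exact: red_nat | apply: redX].
apply: redM; last exact: redV.
by apply: redM => //; apply/redN/red_nat.
Qed.

Lemma laur_red_cquo S s n : laur_red S s -> (forall k, qe (quo 'F_p k) != 0) ->
    (forall k, qc (quo 'F_p k) != 0) ->
  laur_red (cquo S n) (cquo s n).
Proof.
move=> Ss e0 c0; have [hx he hc] := red_quo n e0 c0.
have X := laur_redX.
apply: laur_redD.
  case: n hx he hc => [|n] hx he hc; first by rewrite !laur_polyX.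
  rewrite /quo_poly !(rmorphM (@laur_poly _)) !(rmorphD (@laur_poly _)) /=.
  rewrite !laur_polyC !laur_polyX; apply: laur_redM.
    by apply/laur_redC/redM; [exact: red_nat | exact: (redV (c0 n.+1) hc)].
  by apply: laur_redD => //; apply: laur_redC.
apply: laur_redM; first by apply/laur_redC/redV.
apply: laur_redM; first exact: laur_red_geom.
exact: (laur_redB (laur_redB (laur_redB Ss (laur_red_exp 2 X)) (laur_red_nat 8))
  (laur_redC he)).
Qed.

End Reduction.

(** * Primes of good reduction *)

Section QuadraticFactor.
Variables (F : fieldType) (a : F).
Hypothesis a_sqr : a ^+ 2 = 2.
Hypothesis two_neq0 : 2 != 0 :> F.
Hypothesis three_neq0 : 3 != 0 :> F.
Hypothesis N1_nonsquare : forall y : F, y ^+ 2 != -1.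
Hypothesis three_nonsquare : forall y : F, y ^+ 2 != 3.

(** The factor [G] of [D]; the complementary factor is obtained by replacing [a] with [- a]. *)
Definition quad_factor (x : F) : F := x ^+ 2 + a * x + (9 - 6 * a).

(** The discriminant is [- (4 - 3 a)^2], where [4 - 3 a] is nonzero because its product with
    [4 + 3 a] is [-2]; a root would thus make -1 a square. *)
Lemma quad_factor_neq0 x : quad_factor x != 0.
Proof.
have d0 : 4 - 3 * a != 0.
  apply: contra_neq two_neq0 => d0.
  have : (4 - 3 * a) * (4 + 3 * a) = - 2.
    by transitivity (16 - 9 * a ^+ 2); [ring | rewrite a_sqr; ring].
  by rewrite d0 mul0r => /eqP; rewrite eq_sym oppr_eq0 => /eqP.
apply/eqP => G0; have /eqP[] := N1_nonsquare ((2 * x + a) / (4 - 3 * a)).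
have H : (2 * x + a) ^+ 2 = - (4 - 3 * a) ^+ 2.
  transitivity (4 * quad_factor x + 10 * (a ^+ 2 - 2) - (4 - 3 * a) ^+ 2).
    by rewrite /quad_factor; ring.
  by rewrite G0 a_sqr subrr !mulr0 addr0 add0r.
by rewrite expr_div_n H mulNr divff ?expf_neq0.
Qed.

Lemma quad_factor_step t : qe t != 0 -> quo_rel t ->
  4 * qe t ^+ 2 * (quad_factor (qx t) * quad_factor (qx (quo_step t)))
  = (qe t ^+ 2 + 12 * a * qe t + 89 - 12 * a) ^+ 2.
Proof.
move=> e0 /(quo_step_prod e0) hp.
have hs : qe t * (qx t + qx (quo_step t)) = 12 by rewrite /=; field.
move: (qe t) (qx t) (qx (quo_step t)) hp hs => e x x' hp hs {t e0}.
(* The product is symmetric in [x] and [x'], so it is written through their sum and product, known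
   from [hs] and [hp]. *)
transitivity ((2 * e * x * x') ^+ 2 + 2 * a * (2 * e * x * x') * (e * (x + x'))
  + (9 - 6 * a) * (4 * (e * (x + x')) ^+ 2 - 4 * e * (2 * e * x * x'))
  + 2 * e * a ^+ 2 * (2 * e * x * x')
  + 4 * e * a * (9 - 6 * a) * (e * (x + x')) + 4 * e ^+ 2 * (9 - 6 * a) ^+ 2).
  by rewrite /quad_factor; ring.
rewrite hp hs; apply/eqP; rewrite -subr_eq0; apply/eqP.
transitivity ((a ^+ 2 - 2) * (2 * e * (55 + 16 * e + e ^+ 2) - 288 * e
  + 144 * e ^+ 2 - 144 * (e - 1) ^+ 2)); first ring.
by rewrite a_sqr subrr mul0r.
Qed.

Definition quo_good (t : quo_state F) : Prop :=
  quo_rel t /\ exists y, quad_factor (qx t) = 3 * y ^+ 2.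

(** If [qe t] vanished, [quo_rel] would reduce to [24 x = 55], and then [24^2 G(x) = (89 - 12 a)^2]
    would make 3 a square. *)
Lemma quo_good_neq0 t : quo_good t -> qe t != 0.
Proof.
move=> [rel [y Gy]]; apply/eqP => e0.
move: rel; rewrite /quo_rel e0 => rel.
have {}rel : 24 * qx t = 55.
  by apply/eqP; rewrite -subr_eq0; apply/eqP; rewrite -[RHS]rel; ring.
have y0 : y != 0.
  have := quad_factor_neq0 (qx t); rewrite Gy mulf_eq0 negb_or => /andP[_].
  by rewrite expf_eq0.
have n24 : 24 != 0 :> F.
  by rewrite (_ : 24 = 2 ^+ 3 * 3); [rewrite mulf_neq0 ?expf_neq0 | ring].
have H : 24 ^+ 2 * (3 * y ^+ 2) = (89 - 12 * a) ^+ 2.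
  rewrite -Gy; apply/eqP; rewrite -subr_eq0; apply/eqP.
  transitivity ((24 * qx t) ^+ 2 + 24 * a * (24 * qx t)
    + 576 * (9 - 6 * a) - (89 - 12 * a) ^+ 2).
    by rewrite /quad_factor; ring.
  rewrite rel; transitivity (- 144 * (a ^+ 2 - 2)); first ring.
  by rewrite a_sqr subrr mulr0.
have /eqP[] := three_nonsquare ((89 - 12 * a) / (24 * y)).
by rewrite expr_div_n -H; field; rewrite y0.
Qed.

Lemma quo_good_step t : quo_good t -> quo_good (quo_step t).
Proof.
move=> g; have e0 := quo_good_neq0 g; case: g => rel [y Gy].
split; first exact: quo_rel_step.
have y0 : y != 0.
  have := quad_factor_neq0 (qx t); rewrite Gy mulf_eq0 negb_or => /andP[_].
  by rewrite expf_eq0.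
have := quad_factor_step e0 rel; rewrite Gy.
(* Here [z^2 = 12 e^2 y^2 G(x')], that is, [G(x') = 3 (z / (6 e y))^2]. *)
set z := _ + _ - _ => H; exists (z / (2 * 3 * qe t * y)).
by rewrite expr_div_n -H; field; rewrite y0 e0 -[6]/((2 * 3)%:R) natrM mulf_neq0.
Qed.

Lemma qe_quo_neq0 n : qe (quo F n) != 0.
Proof.
apply: quo_good_neq0; elim: n => [|n IHn]; last exact: quo_good_step.
split; first exact: quo_rel0.
exists (a - 1); rewrite /quad_factor /=.
apply/eqP; rewrite -subr_eq0; apply/eqP.
transitivity (- 3 * (a ^+ 2 - 2)); first ring.
by rewrite a_sqr subrr mulr0.
Qed.

End QuadraticFactor.

(** * Primes modulo which 2 and -3 are squares and -1 is not *)

Lemma prime_3mod4_divisor (g : nat) : (g %% 4 = 3)%N ->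
  exists p : nat, [/\ prime p, (p %| g)%N & (p %% 4 = 3)%N].
Proof.
elim/ltn_ind: g => g IHg g3.
have g1 : (1 < g)%N by case: g g3 {IHg} => [|[]].
have pr := pdiv_prime g1; have /dvdnP[q Eg] := pdiv_dvd g.
move: (pdiv g) pr Eg => p pr Eg.
(* A product congruent to 3 modulo 4 has a factor congruent to 3; if it is not the prime [p], the
   induction continues with the cofactor [q]. *)
have p4 : (p %% 4 = 3 \/ q %% 4 = 3)%N.
  move: g3; rewrite Eg -modnMm.
  have := ltn_pmod p (isT : (0 < 4)%N); have := ltn_pmod q (isT : (0 < 4)%N).
  by case: (p %% 4)%N => [|[|[|[]]]]//; case: (q %% 4)%N => [|[|[|[]]]]//; auto.
case: p4 => [p3|q3]; first by exists p; split=> //; rewrite Eg dvdn_mull.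
have qg : (q < g)%N.
  rewrite Eg -{1}[q]muln1 ltn_pmul2l ?prime_gt1 //.
  by case: q q3 {Eg}.
have [r [r_pr rq r3]] := IHg q qg q3.
by exists r; split=> //; rewrite Eg dvdn_mulr.
Qed.

(** For [p = 4 k + 3] and [y^2 = -1], one has [y = y^p = (y^2)^(2 k + 1) y = - y], impossible in odd
    characteristic. *)
Lemma Fp_N1_nonsquare p : prime p -> (p %% 4 = 3)%N ->
  forall y : 'F_p, y ^+ 2 != -1.
Proof.
move=> pr p3 y; apply/eqP => yy.
have y0 : y != 0.
  by apply: contra_eqN yy => /eqP ->; rewrite expr0n /= eq_sym oppr_eq0 oner_eq0.
have := expf_card y; rewrite card_Fp // => yp.
have {}yp : y ^+ (2 * ((p %/ 4) * 2 + 1)).+1 = y.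
  by rewrite -[RHS]yp; congr (y ^+ _); lia.
move: yp; rewrite exprSr exprM yy exprD exprM exprAC sqrrN !expr1n expr1 mul1r.
rewrite mulN1r => /eqP; rewrite eq_sym -subr_eq0 opprK -mulr2n -mulr_natl.
rewrite mulf_eq0 (negbTE y0) orbF.
by rewrite -(dvdn_pcharf (pchar_Fp pr)) dvdn_prime2 // => /eqP p2; rewrite p2 in p3.
Qed.

(** The polynomial [x^4 + 2 x^2 + 25] is the minimal polynomial of [sqrt 2 + sqrt (-3)], so a
    nonzero root modulo an odd prime yields both square roots. *)
Lemma exists_good_prime (m : nat) : exists p : nat,
  [/\ (m < p)%N, prime p, (p %% 4 = 3)%N,
      exists a : 'F_p, a ^+ 2 = 2 & exists b : 'F_p, b ^+ 2 = - 3].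
Proof.
(* [x] is odd and divisible by every odd number up to [m], so an odd prime not dividing [x] exceeds
   [m]. *)
pose x := (\prod_(i < m.+1) i.*2.+1)%N.
have xodd : odd x.
  rewrite /x; elim/big_rec: _ => [//|i y _ oy].
  by rewrite oddM oy /= odd_double.
have xdvd (p : nat) : odd p -> (p <= m)%N -> (p %| x)%N.
  move=> op pm; have lt : (p./2 < m.+1)%N by lia.
  rewrite /x (bigD1 (Ordinal lt)) //= (_ : (p./2).*2.+1 = p)%N ?dvdn_mulr //; lia.
pose T := (x./2.+1 * x./2)./2.
have ET : (2 * T = x./2.+1 * x./2)%N.
  have : ~~ odd (x./2.+1 * x./2) by rewrite oddM /= andNb.
  by rewrite /T; move: (x./2.+1 * x./2)%N => P; lia.
have Ex : (x ^ 2 = 8 * T + 1)%N.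
  have : (x = 2 * x./2 + 1)%N by lia.
  by move: ET; move: T (x./2) => U t ET ->; nia.
(* A quarter of [x^4 + 2 x^2 + 25], by [x^2 = 8 T + 1]; in this form it is visibly 3 modulo 4. *)
pose g := (16 * T ^ 2 + 8 * T + 7)%N.
have Eg : (4 * g = x ^ 4 + 2 * x ^ 2 + 25)%N.
  rewrite (_ : x ^ 4 = (x ^ 2) ^ 2)%N; last by rewrite -expnM.
  rewrite Ex /g; lia.
have [|p [pr pg p3]] := @prime_3mod4_divisor g; first by rewrite /g; lia.
have podd : odd p by lia.
(* Otherwise [p] divides 25, but 5 is 1 modulo 4. *)
have px : ~~ (p %| x)%N.
  apply/negP => px.
  have : (p %| 4 * g)%N by rewrite dvdn_mull.
  rewrite Eg dvdn_addr; last by rewrite dvdn_add // ?dvdn_mull // dvdn_exp.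
  rewrite -[25%N]/(5 ^ 2)%N Euclid_dvdX // andbT dvdn_prime2 // => /eqP p5.
  by rewrite p5 in p3.
exists p; split=> //.
  by rewrite ltnNge; apply: contra px => /(xdvd _ podd).
all: have X0 : x%:R != 0 :> 'F_p by rewrite -(dvdn_pcharf (pchar_Fp pr)).
all: have two0 : 2 != 0 :> 'F_p
   by rewrite -(dvdn_pcharf (pchar_Fp pr)) dvdn_prime2 //; apply: contraTneq podd => ->.
all: have f0 : x%:R ^+ 4 + 2 * x%:R ^+ 2 + 25 = 0 :> 'F_p
  by rewrite -!natrX -natrM -!natrD -Eg; apply/eqP;
     rewrite -(dvdn_pcharf (pchar_Fp pr)) dvdn_mull.
(* With [f = x^4 + 2 x^2 + 25], both witnesses come from [(x^2 + 5)^2 = f + 8 x^2] and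
   [(x^2 - 5)^2 = f - 12 x^2]. *)
- exists ((x%:R ^+ 2 + 5) / (2 * x%:R)); apply/eqP; rewrite -subr_eq0; apply/eqP.
  transitivity ((x%:R ^+ 4 + 2 * x%:R ^+ 2 + 25) / (2 * x%:R) ^+ 2 : 'F_p).
    by field; rewrite X0 two0.
  by rewrite f0 mul0r.
- exists ((x%:R ^+ 2 - 5) / (2 * x%:R)); apply/eqP; rewrite -subr_eq0; apply/eqP.
  transitivity ((x%:R ^+ 4 + 2 * x%:R ^+ 2 + 25) / (2 * x%:R) ^+ 2 : 'F_p).
    by field; rewrite X0 two0.
  by rewrite f0 mul0r.
Qed.

Lemma exists_good_reduction_prime (m : nat) : exists p : nat,
  [/\ (m < p)%N, prime p, odd p & forall n, qe (quo 'F_p n) != 0].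
Proof.
have [p [mp pr p3 [a aa] [b bb]]] := exists_good_prime (maxn m 3).
have podd : odd p by lia.
exists p; split=> //; first by lia.
have N1 := Fp_N1_nonsquare pr p3.
have nz (q : nat) : prime q -> (q <= 3)%N -> q%:R != 0 :> 'F_p.
  by move=> q_pr q3; rewrite -(dvdn_pcharf (pchar_Fp pr)) dvdn_prime2 //; lia.
apply: (@qe_quo_neq0 _ a) => //; try exact: nz.
(* As -3 is the square of [b], a square root [y] of 3 would give the square root [b / y] of -1. *)
move=> y; apply/eqP => yy; have /eqP[] := N1 (b / y).
by rewrite expr_div_n bb yy mulNr divff // nz.
Qed.

(** * The polynomial is not Pellian *)

Section DivisibilityIdeal.
Variables (p : nat) (e : nat).
Hypothesis p_pr : prime p.

Lemma ZlocD r s : in_Zloc p r -> in_Zloc p s -> in_Zloc p (r + s).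
Proof. by move=> hr hs; have [] := redD p_pr (conj hr erefl) (conj hs erefl). Qed.
Lemma ZlocN r : in_Zloc p r -> in_Zloc p (- r).
Proof. by move=> hr; have [] := redN p_pr (conj hr erefl). Qed.
Lemma ZlocM r s : in_Zloc p r -> in_Zloc p s -> in_Zloc p (r * s).
Proof. by move=> hr hs; have [] := redM p_pr (conj hr erefl) (conj hs erefl). Qed.
Lemma Zloc_int (z : int) : in_Zloc p z%:~R.
Proof. by have [] := red_int p_pr z. Qed.
Lemma Zloc_intV (z : int) : ~~ (p %| absz z)%N -> in_Zloc p (z%:~R^-1).
Proof. by move=> pz; have [] := red_frac p_pr 1 pz; rewrite mul1r. Qed.

(* The ideal generated by [p ^ e] in the localisation of the integers at [p]. *)
Definition Jloc (r : rat) : bool := in_Zloc p (r / (p ^ e)%N%:R).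

Lemma JlocD r s : Jloc r -> Jloc s -> Jloc (r + s).
Proof. by rewrite /Jloc mulrDl; apply: ZlocD. Qed.
Lemma JlocN r : Jloc r -> Jloc (- r).
Proof. by rewrite /Jloc mulNr; apply: ZlocN. Qed.
Lemma JlocM r s : Jloc r -> in_Zloc p s -> Jloc (r * s).
Proof. by rewrite /Jloc mulrAC; apply: ZlocM. Qed.
Lemma Jloc0 : Jloc 0.
Proof. by rewrite /Jloc mul0r; apply: (Zloc_int 0). Qed.
Lemma Jloc_sum (I : Type) (s : seq I) (f : I -> rat) (P : pred I) :
  (forall i, P i -> Jloc (f i)) -> Jloc (\sum_(i <- s | P i) f i).
Proof. by move=> h; elim/big_ind: _ => //; [exact: Jloc0 | exact: JlocD]. Qed.

Lemma Jloc_int (z : int) : Jloc z%:~R = (p ^ e %| absz z)%N.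
Proof.
have q0 : (p ^ e)%N%:R != 0 :> rat by rewrite pnatr_eq0 expn_eq0 -leqn0 leqNgt prime_gt0.
apply/idP/idP => [|/dvdnP[t Et]]; last first.
  have : ((p ^ e)%N%:Z %| z)%Z by rewrite dvdzE /= Et dvdn_mull.
  move=> /dvdzP[y ->]; rewrite /Jloc intrM -[X in _ * X / _]/((p ^ e)%N%:R) mulfK //.
  exact: Zloc_int.
move=> h; have [n [d [pd E _]]] := redP (conj h erefl).
have d0 : d%:~R != 0 :> rat by rewrite intr_eq0; apply: contraNneq pd => ->.
have {}E : z * d = n * (p ^ e)%N%:Z.
  apply: (@intr_inj rat); rewrite !intrM -[(p ^ e)%N%:Z%:~R]/((p ^ e)%N%:R).
  by apply/eqP; rewrite -eqr_div // E.
have : (p ^ e %| absz (z * d)%R)%N by rewrite E abszM /= dvdn_mull.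
by rewrite abszM Gauss_dvdl // coprimeXl // prime_coprime.
Qed.

(** In degrees at least [b + G], the product involves only coefficients of [f] in degrees at least
    [b]. *)
Lemma lc_mul_Jloc (f g : laurent rat) b G :
    (forall n, b <= n -> Jloc (f n)) -> vanish_above g G -> laur_int p g ->
  forall n, b <= n -> Jloc ((f * g) (n + G)).
Proof.
move=> fJ gG gi n bn; have [M fM] := lc_vanish f.
case: (ltP M n) => [lt|le].
  by rewrite (vanishM fM gG) ?Jloc0 //; lia.
rewrite (_ : n + G = M + G - (absz (M - n)%R)%:Z); last lia.
rewrite (lcM _ fM gG); apply: Jloc_sum => i _; have := ltn_ord i => lti.
by apply: JlocM => //; apply: fJ; lia.
Qed.

(** Division from the top degree downwards: each coefficient of [f], times the unit [g G], is a
    coefficient of [f * g] minus terms that contain higher coefficients of [f]. *)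
Lemma lc_div_Jloc (f g : laurent rat) b G :
    vanish_above g G -> laur_int p g -> g G != 0 -> in_Zloc p (g G)^-1 ->
    (forall n, b <= n -> Jloc ((f * g) (n + G))) ->
  forall n, b <= n -> Jloc (f n).
Proof.
move=> gG gi g0 giV fgJ; have [M fM] := lc_vanish f.
suff H d : b <= M - d%:Z -> Jloc (f (M - d%:Z)).
  move=> n bn; case: (ltP M n) => [lt|le]; first by rewrite fM ?Jloc0.
  rewrite (_ : n = M - (absz (M - n)%R)%:Z); last lia.
  by apply: H; lia.
elim/ltn_ind: d => d IHd bd.
have := fgJ _ bd; rewrite (_ : M - d%:Z + G = M + G - d%:Z); last lia.
rewrite (lcM _ fM gG) /conv big_ord_recr /= subnn subr0 => H.
rewrite -[f _](mulfK g0); apply: JlocM => //.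
set s := \sum_(i < d) _ in H; rewrite -[_ * _](addKr s); apply: JlocD => //.
apply: JlocN; apply: Jloc_sum => i _; have := ltn_ord i => lti.
by apply: JlocM => //; apply: IHd => //; lia.
Qed.

End DivisibilityIdeal.

Lemma laur_top (K : comNzRingType) (f : laurent K) : f != 0 ->
  exists N, vanish_above f N /\ f N != 0.
Proof.
move=> f0; have [M fM] := lc_vanish f.
have ex : exists d : nat, f (M - d%:Z) != 0.
  apply: contrapT => nex; move/eqP: f0; apply; apply: (@laur_eqP _ _ _ M) => //.
    by move=> n _; rewrite lc0.
  by move=> d; rewrite lc0; apply/eqP; apply: contrapT => /negP h; apply: nex; exists d.
case: (ex_minnP ex) => d fd dmin; exists (M - d%:Z); split=> // n lt.
case: (ltP M n) => [/fM //|le]; apply/eqP; apply: contraTT lt => fn.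
have := dmin (absz (M - n)%R); rewrite (_ : M - (absz (M - n)%R)%:Z = n); last lia.
by move=> /(_ fn); lia.
Qed.

(** From [n C(k, n) = k C(k - 1, n - 1)], the binomial loses at most [logn 3 n] from the valuation
    of [k], and [logn 3 n + 2 <= n] once [n >= 2]. *)
Lemma logn3_bin (k n : nat) : (2 <= n <= k)%N ->
  (3 ^ (logn 3 k + 2) %| 'C(k, n) * 3 ^ n)%N.
Proof.
move=> /andP[n2 nk].
have C0 : (0 < 'C(k, n))%N by rewrite bin_gt0.
rewrite pfactor_dvdn ?muln_gt0 ?C0 ?expn_gt0 // lognM ?expn_gt0 // pfactorK //.
have E : (n * 'C(k, n) = k * 'C(k.-1, n.-1))%N.
  case: n k n2 nk {C0} => [|n] [|k] // _ _; by rewrite mul_bin_diag.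
have : (logn 3 n + logn 3 'C(k, n) = logn 3 k + logn 3 'C(k.-1, n.-1))%N.
  rewrite -!lognM ?E // ?bin_gt0; lia.
have : (logn 3 n + 2 <= n)%N.
  have : (3 ^ logn 3 n <= n)%N by apply: dvdn_leq; [lia | exact: pfactor_dvdnn].
  case: (logn 3 n) => [//|j] h.
  have : (j.+1 + 2 <= 3 ^ j.+1)%N by elim: j {h} => // j IHj; rewrite expnS; lia.
  lia.
lia.
Qed.

Lemma coef_linear_exp (k n : nat) :
  ((55%:P - 24%:P * 'X : {poly int}) ^+ k)`_n
  = 55 ^+ (k - n) * (- 24) ^+ n *+ 'C(k, n).
Proof.
rewrite -mulNr -polyCN exprDn coef_sum.
have E (i : nat) :
    ((55%:P : {poly int}) ^+ (k - i) * ((- 24)%:P * 'X) ^+ i *+ 'C(k, i))`_n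
   = 55 ^+ (k - i) * (- 24) ^+ i *+ 'C(k, i) *+ (n == i).
  rewrite coefMn exprMn -!polyC_exp mulrA -polyCM coefCM coefXn.
  by rewrite [in LHS]mulr_natr -!mulrnA mulnC.
under eq_bigr => i _ do rewrite E.
case: (leqP n k) => [le|lt].
  rewrite (bigD1 (inord n)) //= inordK // eqxx mulr1n big1 ?addr0 // => i ni.
  rewrite (_ : (n == i :> nat) = false) ?mulr0n //.
  by apply: contraNF ni => /eqP ->; rewrite inord_val.
rewrite bin_small // mulr0n big1 // => i _.
by rewrite (_ : (n == i :> nat) = false) ?mulr0n //; have := ltn_ord i; lia.
Qed.

(** * Integral Pell equations and descent modulo 3 *)

Definition Dgen (K : nzRingType) : {poly K} :=
  'X^4 + 16%:P * 'X^2 + 24%:P * 'X + 9%:P.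

Lemma map_Dgen (K : nzRingType) : map_poly (intr : int -> K) (Dgen int) = Dgen K.
Proof.
have E (n : nat) : map_poly (intr : int -> K) (n%:R)%:P = (n%:R)%:P.
  by rewrite map_polyC /= rmorph_nat.
pose f : {rmorphism {poly int} -> {poly K}} := map_poly intr.
rewrite /Dgen -[map_poly _ _]/(f _) !(rmorphD f) !(rmorphXn f) !(rmorphM f) /=.
by rewrite !map_polyX !E.
Qed.

(* [D(1) = -1] is not a square in [F_3], so 1 is a common root of [P] and [Q], and
   one descends on the degree. *)
Lemma sqr_DgenF3 (P Q : {poly 'F_3}) : P ^+ 2 = Dgen 'F_3 * Q ^+ 2 -> P = 0 /\ Q = 0.
Proof.
have [n] := ubnP (size Q); elim: n P Q => // n IHn P Q szQ PQ.
have [Q0|Q0] := eqVneq Q 0.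
  by move: PQ; rewrite Q0 expr0n mulr0 => /eqP; rewrite expf_eq0 /= => /eqP.
have D1 : (Dgen 'F_3).[1] = -1.
  transitivity (50%:R : 'F_3).
    rewrite /Dgen !(hornerD, hornerM, hornerC, hornerXn, hornerX) !expr1n !mulr1.
    by rewrite -[1]/(1%:R) -!natrD.
  by apply/eqP; rewrite -subr_eq0 opprK natr1 -(dvdn_pcharf (pchar_Fp (isT : prime 3))).
have PQ1 : P.[1] ^+ 2 = - Q.[1] ^+ 2.
  by rewrite -horner_exp PQ hornerM horner_exp D1 mulN1r.
have Q1 : Q.[1] = 0.
  apply/eqP; apply: contraT => Q1.
  have := @Fp_N1_nonsquare 3 isT erefl (P.[1] / Q.[1]).
  by rewrite expr_div_n PQ1 mulNr divff ?expf_neq0 // eqxx.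
have P1 : P.[1] = 0.
  by apply/eqP; move/eqP: PQ1; rewrite Q1 expr0n oppr0 expf_eq0.
have /factor_theorem[P' EP] : root P 1 by apply/eqP.
have /factor_theorem[Q' EQ] : root Q 1 by apply/eqP.
have X0 : ('X - 1%:P) ^+ 2 != 0 :> {poly 'F_3} by rewrite expf_neq0 ?polyXsubC_eq0.
have PQ' : P' ^+ 2 = Dgen 'F_3 * Q' ^+ 2.
  by apply: (mulIf X0); rewrite -exprMn -EP PQ EQ exprMn mulrA.
have Q'0 : Q' != 0 by apply: contraNneq Q0 => Q'0; rewrite EQ Q'0 mul0r.
have [|_ Q0'] := IHn _ _ _ PQ'; last by rewrite Q0' eqxx in Q'0.
by move: szQ; rewrite EQ size_Mmonic ?monicXsubC // size_XsubC addn2.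
Qed.

Lemma map_intr_eq0 (P : {poly int}) : map_poly (intr : int -> 'F_3) P = 0 ->
  exists P', P = 3%:P * P'.
Proof.
move=> P0; exists (\poly_(i < size P) (P`_i %/ 3)%Z); apply/polyP => i.
rewrite coefCM coef_poly; case: ltnP => [lt|le]; last by rewrite nth_default ?mulr0.
have /eqP : (map_poly (intr : int -> 'F_3) P)`_i = 0 by rewrite P0 coef0.
rewrite coef_map /= -(dvdz_pcharf (pchar_Fp (isT : prime 3))) => h.
by rewrite mulrC divzK.
Qed.

(** If 3 divides [c], then modulo 3 the equation forces [P] and [Q] to vanish; dividing both by 3
    divides [c] by 9, and one descends on the absolute value of [c]. *)
Lemma pell_coprime3 (P Q : {poly int}) (c : int) :
    Q != 0 -> c != 0 -> P ^+ 2 - Dgen int * Q ^+ 2 = c%:P ->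
  exists P Q : {poly int}, exists c : int, [/\ Q != 0, ~~ (3 %| absz c)%N
    & P ^+ 2 - Dgen int * Q ^+ 2 = c%:P].
Proof.
have [n] := ubnP (absz c); elim: n P Q c => // n IHn P Q c cn Q0 c0 PQ.
have [c3|c3] := boolP (3 %| absz c)%N; last by exists P, Q, c.
pose r : {rmorphism {poly int} -> {poly 'F_3}} := map_poly intr.
have [|/map_intr_eq0[P' EP] /map_intr_eq0[Q' EQ]] := @sqr_DgenF3 (r P) (r Q).
  apply/eqP; rewrite -subr_eq0 -!rmorphXn -[Dgen 'F_3]map_Dgen -[map_poly _ _]/(r _).
  rewrite -rmorphM -rmorphB PQ /= map_polyC /= polyC_eq0.
  by rewrite -(dvdz_pcharf (pchar_Fp (isT : prime 3))) dvdzE.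
have E9 : 9%:P * (P' ^+ 2 - Dgen int * Q' ^+ 2) = c%:P.
  rewrite -PQ EP EQ (_ : 9%:P = 3%:P * 3%:P) -?polyCM //; ring.
pose c' := (P' ^+ 2 - Dgen int * Q' ^+ 2)`_0.
have Ec : c = 9 * c' by rewrite -coefCM E9 coefC.
apply: (IHn P' Q' c').
- by move: cn; rewrite Ec abszM; move: c0; rewrite Ec mulf_eq0 /=; lia.
- by apply: contraNneq Q0 => Q'0; rewrite EQ Q'0 mulr0.
- by move: c0; rewrite Ec mulf_eq0.
apply: (@mulfI _ 9%:P); first by rewrite polyC_eq0.
by rewrite E9 Ec polyCM.
Qed.

Lemma pellian_int : pellian Dpoly ->
  exists P Q : {poly int}, exists c : int, [/\ Q != 0, c != 0
    & P ^+ 2 - Dgen int * Q ^+ 2 = c%:P].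
Proof.
move=> [P [Q [Q0 [c [c0 PQ]]]]].
have [P1 [a a0 EP]] := rat_poly_scale P; have [Q1 [b b0 EQ]] := rat_poly_scale Q.
pose r : {rmorphism {poly int} -> {poly rat}} := map_poly intr.
have ra (z : int) : r z%:P = (z%:~R)%:P by rewrite /= map_polyC.
have aQ : a%:~R != 0 :> rat by rewrite intr_eq0.
have bQ : b%:~R != 0 :> rat by rewrite intr_eq0.
have {}EP : r P1 = (a%:~R)%:P * P.
  by rewrite EP mul_polyC scalerA divff // scale1r.
have {}EQ : r Q1 = (b%:~R)%:P * Q.
  by rewrite EQ mul_polyC scalerA divff // scale1r.
(* The cross factors give [P] and [Q] the same denominator [a b], so the norm is multiplied by
   [(a b)^2]. *)
pose E := (b%:P * P1) ^+ 2 - Dgen int * (a%:P * Q1) ^+ 2.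
have rE : r E = ((a%:~R * b%:~R) ^+ 2 * c)%:P.
  rewrite /E (rmorphB r) !(rmorphM r) !ra EP EQ [r (Dgen _)]map_Dgen.
  rewrite polyCM -PQ -[Dpoly]/(Dgen rat) polyC_exp polyCM; ring.
have Einj : E = (E`_0)%:P.
  have rc i : (E`_i)%:~R = (r E)`_i by rewrite coef_map.
  apply/polyP => i; apply: (@intr_inj rat).
  by rewrite rc rE !coefC; case: eqP => // _; rewrite rc rE coefC.
exists (b%:P * P1), (a%:P * Q1), E`_0; split=> //.
- rewrite mulf_neq0 ?polyC_eq0 //.
  by apply: contraNneq Q0 => Q10; move: EQ; rewrite Q10 rmorph0 => /esym/eqP;
     rewrite mulf_eq0 polyC_eq0 (negbTE bQ).
apply: contraNneq c0 => E0; move: rE; rewrite Einj E0 rmorph0 => /esym/eqP.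
by rewrite polyC_eq0 mulf_eq0 expf_eq0 /= mulf_eq0 (negbTE aQ) (negbTE bQ).
Qed.

(** * Units with integral coefficients as Laurent series *)

Definition laurz : {poly int} -> laurent rat :=
  @laur_poly rat \o map_poly intr.
HB.instance Definition _ := GRing.RMorphism.on laurz.

Lemma lc_laurz P n : laurz P n = if 0 <= n then (P`_(absz n))%:~R else 0.
Proof. by rewrite lc_poly coef_map. Qed.

Lemma laurzC c : laurz c%:P = laur_const c%:~R.
Proof. by rewrite /laurz /= map_polyC laur_polyC. Qed.

Lemma laurzX : laurz 'X = laurX rat.
Proof. by rewrite /laurz /= map_polyX laur_polyX. Qed.

Lemma laurz_Dgen : laurz (Dgen int) = Dlaur rat.
Proof. by rewrite /laurz /= map_Dgen -laur_poly_Dpoly. Qed.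

Lemma laurz_int p P : prime p -> laur_int p (laurz P).
Proof.
move=> pr n; rewrite lc_laurz; case: ifP => _; first exact: Zloc_int.
exact: (Zloc_int pr 0).
Qed.

Section NotPellian.
Variable S : laurent rat.
Hypothesis S_sqr : S * S = Dlaur rat.
Hypothesis S_vanish : vanish_above S 2.
Hypothesis S_lead : S 2 = 1.

(** An element of [Z[X][sqrt D]] is carried together with its conjugate, since conjugation is not an
    operation on Laurent series. *)
Definition conj_pair (f g : laurent rat) : Prop :=
  exists A B : {poly int}, f = laurz A + laurz B * S /\ g = laurz A - laurz B * S.

Lemma conj_pairM f g f' g' : conj_pair f g -> conj_pair f' g' ->
  conj_pair (f * f') (g * g').
Proof.
move=> [A [B [-> ->]]] [A' [B' [-> ->]]].
exists (A * A' + Dgen int * B * B'), (A * B' + A' * B).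
pose L : {rmorphism {poly int} -> laurent rat} := laurz.
rewrite -![laurz _]/(L _) !(rmorphD L) !(rmorphM L) [L (Dgen _)]laurz_Dgen -S_sqr.
by split; ring.
Qed.

Lemma conj_pairX f g k : conj_pair f g -> conj_pair (f ^+ k) (g ^+ k).
Proof.
move=> h; elim: k => [|k IHk]; last by rewrite !exprS; apply: conj_pairM.
by exists 1, 0; rewrite rmorph1 rmorph0 mul0r addr0 subr0.
Qed.

Lemma conj_pair_int f g : conj_pair f g -> laur_int 3 f /\ laur_int 3 g.
Proof.
have Si := @sqrtD_int 3 isT S S_sqr S_vanish S_lead isT.
move=> [A [B [-> ->]]]; have Ai := @laurz_int 3 A isT; have Bi := @laurz_int 3 B isT.
by split; [apply: laur_intD | apply: laur_intB] => //; apply: laur_intM.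
Qed.

Let X := laurX rat.

Lemma no_pell_unit (u v : laurent rat) (c : int) (k : nat) :
    conj_pair u v -> u * v = laur_const c%:~R -> ~~ (3 %| absz c)%N ->
    vanish_above u k.+1%:Z -> u k.+1%:Z != 0 -> vanish_above v (- k.+1%:Z) ->
  False.
Proof.
move: (k.+1) (ltn0Sn k) => {}k k0 uv uvc c3 uk uk0 vk.
have pr3 : prime 3 by [].
have c0 : c%:~R != 0 :> rat by rewrite intr_eq0; apply: contraNneq c3 => ->.
pose w := X ^+ 2 + 8 + S; pose w' := X ^+ 2 + 8 - S.
have ww' : conj_pair w' w.
  exists ('X ^+ 2 + 8%:P), (- 1).
  pose L : {rmorphism {poly int} -> laurent rat} := laurz.
  have L8 : laurz 8%:P = 8 by rewrite laurzC -(rmorph_nat (@laur_const rat)).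
  rewrite -![laurz _]/(L _) !(rmorphD L) !(rmorphXn L) !(rmorphN L) !(rmorph1 L).
  by rewrite /= L8 laurzX /w /w' /X; split; ring.
have wE : w' * w = 55 - 24 * X.
  transitivity ((X ^+ 2 + 8) ^+ 2 - S * S); first by rewrite /w /w'; ring.
  by rewrite S_sqr /Dlaur -/X; ring.
(* [F] is the conjugate of [h]. The degrees [-2 k] of [v ^+ 2] and [2 k] of [w ^+ k] cancel. *)
pose h := v ^+ 2 * w ^+ k; pose F := u ^+ 2 * w' ^+ k.
have Fh : conj_pair F h by apply: conj_pairM; apply: conj_pairX.
have FhE : F * h = laurz (c%:P ^+ 2 * (55%:P - 24%:P * 'X) ^+ k).
  transitivity ((u * v) ^+ 2 * (w' * w) ^+ k).
    by rewrite /F /h !exprMn; ring.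
  pose L : {rmorphism {poly int} -> laurent rat} := laurz.
  have Ln (n : nat) : laurz (n%:R)%:P = n%:R.
    by rewrite laurzC natz -[_%:~R]/(n%:R) rmorph_nat.
  rewrite uvc wE -[laurz _]/(L _) (rmorphM L) (rmorphXn L) (rmorphXn L) (rmorphB L).
  by rewrite (rmorphM L) /= laurzC laurzX !Ln.
have w2 : vanish_above w 2 /\ w 2 = 2.
  have -> : w = laurX rat * (laurX rat * 1) + laur_const 8 + S.
    by rewrite /w /X rmorph_nat; ring.
  split=> [n lt|]; rewrite !lcD !lcXM lc1 lcC; last by rewrite S_lead /= addr0.
  rewrite S_vanish // (gt_eqF (_ : 0 < n)); last lia.
  by rewrite (gt_eqF (_ : 0 < n - 1 - 1)) ?addr0 //; lia.
have vh : vanish_above h 0.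
  rewrite (_ : 0 = (- k%:Z) * 2%:Z + 2 * k%:Z); last by lia.
  by apply: vanishM; apply: vanishX => //; case: w2.
have uv0 : u k * v (- k%:Z) = c%:~R.
  by rewrite -lcM_top // uvc addrN lcC eqxx.
have v0 : v (- k%:Z) != 0.
  by apply: contraNneq c0 => v0; rewrite -uv0 v0 mulr0.
have h0E : h 0 = v (- k%:Z) ^+ 2 * 2 ^+ k.
  rewrite (_ : 0 = (- k%:Z) * 2%:Z + 2 * k%:Z); last by lia.
  have [wv wl] := w2.
  rewrite lcM_top; [|exact: vanishX|exact: vanishX].
  by rewrite (lcX_top 2 vk) (lcX_top k wv) wl.
have h0 : h 0 != 0 by rewrite h0E mulf_neq0 ?expf_neq0.
have [ui _] := conj_pair_int uv; have [Fi hi] := conj_pair_int Fh.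
(* The leading coefficients of [u] and [v] multiply to [c], which is prime to 3, so the inverse of
   one is the other divided by [c]. *)
have h0V : in_Zloc 3 (h 0)^-1.
  have -> : (h 0)^-1 = (u k / c%:~R) ^+ 2 * ((2 ^+ k : int)%:~R)^-1.
    have uk0' : u k != 0 by [].
    rewrite h0E rmorphXn /= -uv0; field.
    by rewrite uk0' v0 expf_neq0.
  apply: ZlocM => //; last first.
    by apply: Zloc_intV => //; rewrite abszX Euclid_dvdX.
  have ci := Zloc_intV pr3 c3.
  by rewrite expr2; apply: ZlocM => //; apply: ZlocM.
(* One more than the 3-adic valuation of the coefficient of [X] in [F * h], while [3 ^ e] divides
   all higher coefficients by [logn3_bin]. *)
pose e := (logn 3 k + 2)%N.
have coefE (n : nat) :
    (F * h) n%:Z = (c ^+ 2 * (55 ^+ (k - n) * (- 24) ^+ n *+ 'C(k, n)))%:~R.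
  by rewrite FhE lc_laurz /= -polyC_exp coefCM coef_linear_exp.
have J2 n : 2 <= n -> Jloc 3 e ((F * h) (n + 0)).
  case: n => // n n2; rewrite addr0 coefE Jloc_int //.
  case: (leqP n k) => [nk|kn]; last by rewrite bin_small // mulr0n mulr0 dvdn0.
  rewrite -mulr_natr natz !abszM !abszX (_ : absz (- 24)%R = (8 * 3)%N) // expnMn /=.
  rewrite (_ : (_ * _)%N = (absz c ^ 2 * (55 ^ (k - n) * 8 ^ n)
     * ('C(k, n) * 3 ^ n))%N); last by rewrite (natz (binomial k n)) /=; ring.
  by rewrite dvdn_mull // logn3_bin // nk andbT.
have FJ2 := lc_div_Jloc pr3 vh hi h0 h0V J2.
have [A [B [FE hE]]] := Fh.
have Si := @sqrtD_int 3 isT S S_sqr S_vanish S_lead isT.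
(* Since [S] has degree 2 and leading coefficient 1, the coefficients of [F - h] in degrees at least
   2 control the whole polynomial [2 B], and through it all of [F - h]. *)
have BS : (laurz B + laurz B) * S = F - h by rewrite FE hE; ring.
have BJ0 : forall n, 0 <= n -> Jloc 3 e ((laurz B + laurz B) n).
  apply: (lc_div_Jloc pr3 S_vanish Si); rewrite ?S_lead ?oner_neq0 ?invr1 //.
  move=> n n0; rewrite BS lcB vh ?subr0; last lia.
  by apply: FJ2; lia.
have F1 n : 1 <= n -> Jloc 3 e (F n).
  move=> n1; have : Jloc 3 e ((F - h) n).
    rewrite -BS (_ : n = n - 2 + 2); last lia.
    apply: (@lc_mul_Jloc 3 e pr3 _ _ (n - 2)) => // i _.
    case: (leP 0 i) => [/BJ0 //|i0].
    by rewrite lcD !lc_laurz leNgt i0 /= addr0; apply: Jloc0.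
  by rewrite lcB vh ?subr0 //; lia.
(* So [3 ^ e] divides the coefficient [c^2 55^(k - 1) (-24) k] of [X] in [F * h], whose valuation is
   only [logn 3 k + 1]. *)
have := @lc_mul_Jloc 3 e pr3 _ _ 1 0 F1 vh hi 1 isT.
have c1 : (0 < absz c)%N by rewrite lt0n absz_eq0; move: c0; rewrite intr_eq0.
rewrite addr0 (coefE 1%N) Jloc_int //.
have -> : absz (c ^+ 2 * (55 ^+ (k - 1) * (- 24) ^+ 1 *+ 'C(k, 1)))%R
    = (absz c ^ 2 * (55 ^ (k - 1) * 24 * k))%N.
  by rewrite bin1 -mulr_natr (natz k) expr1 !abszM !abszX.
have lc0 : logn 3 (absz c) = 0%N by rewrite lognE (negbTE c3) !andbF.
have l55 : logn 3 (55 ^ (k - 1)) = 0%N.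
  by rewrite lognX (_ : logn 3 _ = 0%N) ?muln0.
rewrite pfactor_dvdn ?muln_gt0 ?expn_gt0 ?c1 ?k0 //.
rewrite !lognM ?muln_gt0 ?expn_gt0 ?c1 ?k0 // lc0 l55 (_ : logn 3 24 = 1%N) //.
by rewrite /e; lia.
Qed.

Lemma not_pellian : ~ pellian Dpoly.
Proof.
move=> /pellian_int[P0 [Q0 [c0 [Q00 c00 E0]]]].
have [P [Q [c [Qn0 c3 E]]]] := pell_coprime3 Q00 c00 E0.
pose L : {rmorphism {poly int} -> laurent rat} := laurz.
pose u := laurz P + laurz Q * S; pose v := laurz P - laurz Q * S.
have uvp : conj_pair u v by exists P, Q.
have vup : conj_pair v u.
  exists P, (- Q); rewrite -[laurz (- Q)]/(L (- Q)) rmorphN /= /u /v.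
  by split; ring.
have uv : u * v = laur_const c%:~R.
  rewrite -laurzC -E -[laurz (_ - _)]/(L _) (rmorphB L) !(rmorphXn L).
  rewrite (rmorphM L) (rmorphXn L).
  by rewrite [L (Dgen _)]laurz_Dgen -S_sqr /u /v -![laurz _]/(L _); ring.
have cn0 : c%:~R != 0 :> rat by rewrite intr_eq0; apply: contraNneq c3 => ->.
have C0 : laur_const c%:~R != 0 :> laurent rat.
  apply: contraNneq cn0 => /(congr1 (fun f : laurent rat => f 0)).
  by rewrite lcC lc0 eqxx => ->.
have u0 : u != 0 by apply: contraNneq C0 => u0; rewrite -uv u0 mul0r.
have v0 : v != 0 by apply: contraNneq C0 => v0; rewrite -uv v0 mulr0.
have [N [uN uN0]] := laur_top u0; have [M [vM vM0]] := laur_top v0.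
have NM : N + M = 0.
  apply/eqP; apply: contraT => NM; have := lcM_top uN vM.
  by rewrite uv lcC (negbTE NM) => /esym/eqP; rewrite mulf_eq0 (negbTE uN0) (negbTE vM0).
have EM : M = - N by lia.
(* The degrees of [u] and [v] are opposite; if they are nonzero, the one of positive degree plays
   the role of the unit. *)
case: (ltgtP 0 N) => [N0|N0|N0].
- have EN : N = (absz N).-1.+1%:Z by lia.
  by rewrite EM EN in vM; rewrite EN in uN uN0; apply: (no_pell_unit uvp uv c3 uN uN0 vM).
- have EN : M = (absz M).-1.+1%:Z by lia.
  rewrite (_ : N = - M) in uN; last lia.
  rewrite EN in uN; rewrite EN in vM vM0; rewrite mulrC in uv.
  exact: (no_pell_unit vup uv c3 vM vM0 uN).
(* If both degrees are 0, then [u - v = 2 Q S] has degree at most 0, although [Q] is nonzero and [S]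
   has degree 2. *)
have d0 : vanish_above (u - v) 0.
  by apply: vanishD; [rewrite N0 | apply: vanishN; rewrite (_ : 0 = M) //; lia].
have sQ : vanish_above (laurz Q + laurz Q) (size Q).-1%:Z.
  move=> n lt; rewrite lcD lc_laurz ifT; last by clear -lt; lia.
  by rewrite nth_default ?mulr0z ?addr0 //; move: (size Q) lt => z lt; clear -lt; lia.
have := d0 ((size Q).-1%:Z + 2).
rewrite (_ : u - v = (laurz Q + laurz Q) * S); last first.
  by rewrite /u /v; ring.
rewrite (lcM_top sQ S_vanish) S_lead mulr1 lcD lc_laurz /= -/(lead_coef Q) -mulr2n => H.
have /eqP := H ltac:(lia).
by rewrite -mulr_natr mulf_eq0 orbF intr_eq0 lead_coef_eq0 (negbTE Qn0).
Qed.

End NotPellian.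

(** * The expansion of [alpha] and its reduction *)

Lemma alpha_ofX (s : lser rat) :
  laurX rat * of_lser (alpha_of s) = of_lser s - 3.
Proof.
rewrite -(rmorph_nat (@laur_const rat)); apply: laurentP => n.
by rewrite lcXM lcB lcC /= subrK.
Qed.

Theorem mainTheorem6 (s : lser rat)
  (hs : leqs (lmul s s) (lpoly Dpoly))
  (hlead : lcoef s 2 = 1 /\ forall n : int, 2 < n -> lcoef s n = 0) :
  ~ pellian Dpoly /\
  forall m : nat, exists p : nat, (m < p)%N /\ prime p /\
    good_reduction p (alpha_of s) /\
    (forall A : nat -> lser rat, cf_seq A (alpha_of s) ->
       forall (n : nat) (k : int), in_Zloc p (lcoef (lfloor (A n)) k)).
Proof.
case: hlead => hlead hvan; pose S := of_lser s.
have SS : S * S = Dlaur rat.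
  by rewrite -of_lserM -laur_poly_Dpoly -of_lpoly; apply/of_lserP.
have Sv : vanish_above S 2 by [].
have Sl : S 2 = 1 by [].
split; first exact: (not_pellian SS Sv Sl).
move=> m; have [p [mp pr podd qe0]] := exists_good_reduction_prime m.
exists p; split=> //; split=> //.
have p2 : 2 != 0 :> 'F_p.
  rewrite -(dvdn_pcharf (pchar_Fp pr)) dvdn_prime2 //.
  by apply: contraTneq podd => ->.
have qc0 := qc_neq0 p2 qe0.
(* [T] is the square root of [D] over ['F_p] with leading term [X^2], so its expansion is given by
   the same recursion as that of [S]. *)
pose T := of_lser (lred p s).
have ST : laur_red S T by have Si := sqrtD_int pr SS Sv Sl podd; split.
have TT : T * T = Dlaur 'F_p.
  by apply: (laur_red_inj _ (laur_red_Dlaur pr)); rewrite -SS; apply: laur_redM.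
have Tv : vanish_above T 2.
  by move=> n /Sv Sn; have [_ <-] := ST n; rewrite Sn; have [] := red0 pr.
have Tl : T 2 = 1 by have [_ <-] := ST 2; rewrite Sl; have [] := red_nat pr 1.
(* Nonvanishing over the rationals follows from nonvanishing modulo [p]. *)
have qeQ n : qe (quo rat n) != 0.
  apply: contra_neq (qe0 n) => E; have [_ [_ <-] _] := red_quo pr n qe0 qc0.
  by rewrite E; have [] := red0 pr.
have cfS := laur_cf_cquo SS Sv Sl isT qeQ.
have cfT := laur_cf_cquo TT Tv Tl p2 qe0.
have ared n := laur_red_cquo pr n ST qe0 qc0.
have aE : of_lser (alpha_of s) = cquo S 0 by apply: cquo0E; exact: alpha_ofX.
split.
  exists (fun n => to_lser (cquo S n)), (fun n => to_lser (cquo T n)).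
  split; [|split].
  - apply/cf_seqE; rewrite aE (_ : (fun n => _) = cquo S) //.
    by apply/funext => n; rewrite to_lserK.
  - apply/cf_seqE; rewrite (_ : of_lser (lred p _) = cquo T 0).
      rewrite (_ : (fun n => _) = cquo T) //.
      by apply/funext => n; rewrite to_lserK.
    apply: laurentP => n; rewrite -(ared 0%N n).2 -aE //.
  move=> n; split=> k; first by have [] := ared n k.
  by have [_] := ared n k.
(* By uniqueness any expansion is the one already found, and a coefficient of a floor is either 0 or
   a coefficient of the quotient. *)
move=> A /cf_seqE; rewrite aE => cfA n k /=.
have := laur_cf_unique cfA cfS n => En.
case: ifP => _; last by have [] := red0 pr.
rewrite -[lcoef _ _]/(of_lser (A n) k) En; by have [] := ared n k.
Qed.
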